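(* Let $(E,f)$ be a polymatroid with $f(E)>0$ and $\mathbf{1}(x)=\sum_{e\in E}x_e$. Every $\mathbf{1}$-cellular string on $P_f$ is coherent. In particular, the Baues poset $\mathrm{Baues}(P_f,\mathbf{1})$ is isomorphic to the face lattice of the monotone path polytope $\mathrm{MPP}_{\mathbf{1}}(P_f)$.
   Context: Polymatroid: $f:2^E\to\mathbb{R}_{\ge0}$, $f(\emptyset)=0$, $f(A)\le f(A\cup B)\le f(A)+f(B)-f(A\cap B)$; $P_f=\{x\ge0:\sum_{e\in A}x_e\le f(A)\ \forall A\subseteq E\}$. For a polytope $P$, linear $c$ not constant on $P$, and a face $F$ on which $c$ is non-constant, write $F^c$, $F^{-c}$ for the faces of $F$ maximizing resp. minimizing $c$; $P_{\min}=P^{-c}$, $P_{\max}=P^c$. A $c$-cellular string is a sequence of faces $(F_0,\dots,F_r)$ of $P$, $c$ non-constant on each, with $F_0^{-c}\subseteq P_{\min}$, $F_r^c\subseteq P_{\max}$ and $F_i^c=F_i\cap F_{i+1}=F_{i+1}^{-c}$ for $0\le i<r$. The Baues poset is the set of cellular strings ordered by refinement (replacing some $F_i$ by a cellular string of $(F_i,c)$). For $w\in\mathbb{R}^d$ let $\pi(x)=(\langle c,x\rangle,\langle w,x\rangle)$; the upper boundary of the polygon $\pi(P)$ (points $(s,t)$ with $(s,t+\epsilon)\notin\pi(P)$ for all $\epsilon>0$) is a path of edges $e_1,\dots,e_r$ from left to right, and $(\{x\in P:\pi(x)\in e_i\})_{i}$ is the coherent cellular string of $w$; a cellular string is coherent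 if it arises this way for some $w$. $\mathrm{MPP}_c(P)=\{2\int_I\gamma\,ds\}$ over continuous sections $\gamma:I=c(P)\to P$ with $\langle c,\gamma(s)\rangle=s$. *)

(* Defs.v *)
From HB Require Import structures.
From mathcomp Require Import all_boot all_order all_algebra.
From mathcomp Require Import all_classical all_reals all_analysis.

Set Implicit Arguments.
Unset Strict Implicit.
Unset Printing Implicit Defensive.

Import Order.TTheory GRing.Theory Num.Theory.
Import numFieldNormedType.Exports.
Local Open Scope classical_set_scope.
Local Open Scope ring_scope.

Section Faces.
Variables (R : realType) (V : lmodType R).
Implicit Types (P F : set V) (c : V -> R).

Definition face_max c P : set V :=
  [set x | P x /\ forall y, P y -> c y <= c x].

Definition face_min c P : set V :=
  [set x | P x /\ forall y, P y -> c x <= c y].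

(* Only nonempty faces; the zero functional gives P itself. *)
Definition is_face P F : Prop :=
  F !=set0 /\ exists u : {scalar V}, F = face_max u P.

Definition nonconstant_on c F : Prop :=
  exists x y, [/\ F x, F y & c x <> c y].

Definition segment (p q : V) : set V :=
  [set a *: p + (1 - a) *: q | a in [set a : R | 0 <= a <= 1]].

Definition is_edge P F : Prop :=
  is_face P F /\ exists p q, p <> q /\ F = segment p q.

End Faces.

Section CellularStrings.
Variables (R : realType) (V : lmodType R).
Implicit Types (P : set V) (s t : seq (set V)).

Definition cellular_string P (c : {scalar V}) s : Prop :=
  [/\ s <> [::],
      forall i, (i < size s)%N ->
        is_face P (nth set0 s i) /\ nonconstant_on c (nth set0 s i),
      face_min c (head set0 s) `<=` face_min c P,
      face_max c (last set0 s) `<=` face_max c P &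
      forall i, (i.+1 < size s)%N ->
        face_max c (nth set0 s i) = nth set0 s i `&` nth set0 s i.+1 /\
        nth set0 s i `&` nth set0 s i.+1 = face_min c (nth set0 s i.+1)].

(* s arises from t by replacing each t_i by a cellular string of (t_i, c).
   The replacements are simultaneous: when c is constant on positive-dimensional
   faces, replacing a single t_i need not give a cellular string. Since
   [:: t_i] is a cellular string of (t_i, c), any t_i may be left as it is. *)
Definition refines (c : {scalar V}) s t : Prop :=
  exists ss : seq (seq (set V)),
    [/\ size ss = size t,
        s = flatten ss &
        forall i, (i < size t)%N ->
          cellular_string (nth set0 t i) c (nth [::] ss i)].

End CellularStrings.

Section UpperBoundary.
Variable R : realType.
Implicit Types (Q : set (R * R)) (es : seq (set (R * R))).

Definition upper_boundary Q : set (R * R) :=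
  [set p | Q p /\ forall eps : R, 0 < eps -> ~ Q (p.1, p.2 + eps)].

Definition upper_edge Q (e : set (R * R)) : Prop :=
  is_edge Q e /\ e `<=` upper_boundary Q.

(* No upper edge is vertical, so the ordering condition rules out repetitions
   and determines es. *)
Definition upper_path Q es : Prop :=
  (forall e, e \in es <-> upper_edge Q e) /\
  (forall i j, (i < j < size es)%N ->
    forall p q, nth set0 es i p -> nth set0 es j q -> p.1 <= q.1).

End UpperBoundary.

Section RE.
Variables (R : realType) (E : finType).
Local Notation V := {ffun E -> R}.
Implicit Types (P : set V) (w x : V).

Definition dot w x : R := \sum_(e : E) w e * x e.

Definition coordsum x : R := \sum_(e : E) x e.

Fact coordsum_is_linear : scalar coordsum.
Proof.
move=> a x y; rewrite /coordsum mulr_sumr -big_split /=.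
by apply: eq_bigr => e _; rewrite !ffunE.
Qed.

HB.instance Definition _ :=
  GRing.isLinear.Build R V R *%R coordsum coordsum_is_linear.

Definition shadow (c : {scalar V}) w x : R * R := (c x, dot w x).

Definition coherent_string_of P (c : {scalar V}) w (s : seq (set V)) : Prop :=
  exists2 es, upper_path (shadow c w @` P) es &
    s = [seq P `&` shadow c w @^-1` e | e : set (R * R) <- es].

Definition coherent P (c : {scalar V}) (s : seq (set V)) : Prop :=
  exists w, coherent_string_of P c w s.

Definition is_section P (c : {scalar V}) (gamma : R -> V) : Prop :=
  (forall s : R, (c @` P) s -> P (gamma s) /\ c (gamma s) = s) /\
  (forall e : E, {within (c @` P : set R), continuous (fun s => gamma s e)}).

Definition monotone_path_polytope P (c : {scalar V}) : set V :=
  [set [ffun e => 2 * \int[lebesgue_measure]_(s in c @` P) gamma s e] |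
    gamma in is_section P c].

Definition polymatroid (f : {set E} -> R) : Prop :=
  [/\ f finset.set0 = 0,
      forall A, 0 <= f A &
      forall A B, f A <= f (A :|: B) <= f A + f B - f (A :&: B)].

Definition polymatroid_polytope (f : {set E} -> R) : set V :=
  [set x | (forall e, 0 <= x e) /\
           forall A : {set E}, \sum_(e in A) x e <= f A].

End RE.

Arguments coordsum {R E} x.

Definition order_isomorphic (T U : Type) (A : set T) (leA : T -> T -> Prop)
    (B : set U) (leB : U -> U -> Prop) : Prop :=
  exists phi : T -> U, set_bij A B phi /\
    forall x y, A x -> A y -> (leA x y <-> leB (phi x) (phi y)).

(* Main.v *)
(** For a weight [w] and a real [t], let [cell w t] be the face of [P = P_f] on
    which [w - t * 1] is maximal. The greedy algorithm describes it explicitly: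
    it consists of the points of [P] that are tight on every strict superlevel
    set of [w] of level at least [t] and vanish where [w < t]. In particular
    [1] ranges over [f {w > t}, f {w >= t}] on it, and the cells of the slopes
    [t] at which this interval is nondegenerate, in decreasing order, form a
    cellular string, which is the coherent string of [w].

    Conversely let [F_i] be the faces of a cellular string, [F_i] exposed by
    [u_i]. By the explicit description a face is determined by its
    [1]-minimal face and by the set of coordinates on which [u_i >= 0]. As the
    minimal face of [F_(i+1)] is the maximal face of [F_i], induction shows that
    [F_i = cell w (- i)] for [w e = - min {i | 0 <= u_i e}].

    A section maximizes the integral of [w] if and only if it stays in the cells
    of [w]. So the face of the monotone path polytope exposed by [w] consists of
    the integrals of the sections that follow the string of [w]. Through every
    point of a cell there is such a section, hence inclusion of faces is
    inclusion of the unions of the strings, and this amounts to refinement. *)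
Require Import Defs.
From HB Require Import structures.
From mathcomp Require Import all_boot all_order all_algebra.
From mathcomp Require Import all_classical all_reals all_analysis.
From mathcomp Require Import ring lra.
Import Order.TTheory GRing.Theory Num.Theory.
Import numFieldNormedType.Exports.
Local Open Scope classical_set_scope.
Local Open Scope ring_scope.

Set Implicit Arguments.
Unset Strict Implicit.
Unset Printing Implicit Defensive.

(** * Greedy points of a polymatroid *)
Section Greedy.
Variables (R : realType) (E : finType).
Implicit Types (f g : {set E} -> R) (A B D : {set E}).

Lemma polymatroid_mono f A B : polymatroid f -> A \subset B -> f A <= f B.
Proof.
case=> _ _ hf /finset.setUidPr AB; have /andP[] := hf A B.
by rewrite AB.
Qed.

Lemma polymatroid_submod f A B :
  polymatroid f -> f (A :|: B) + f (A :&: B) <= f A + f B.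
Proof. by case=> _ _ /(_ A B)/andP[_]; rewrite lerBrDr. Qed.

(** Greedy points of the truncation have coordinate sum [s] as soon as [s] is at most the value of
    [f] on all of [E]. Submodularity survives: if [f A] or [f B] exceeds [s], the union is capped
    too and monotonicity suffices. *)
Lemma polymatroid_trunc f s :
  polymatroid f -> 0 <= s -> polymatroid (fun A => Num.min s (f A)).
Proof.
move=> hf s0; have [f0 fge0 _] := hf; split=> [|A|A B].
- by rewrite f0 min_r.
- by rewrite le_min s0 fge0.
have AU := polymatroid_mono hf (finset.subsetUl A B).
have BU := polymatroid_mono hf (finset.subsetUr A B).
have IA := polymatroid_mono hf (finset.subsetIl A B).
have IB := polymatroid_mono hf (finset.subsetIr A B).
have sm := polymatroid_submod A B hf.
rewrite lerBrDr /Order.min; apply/andP; split; do ?case: ifP; lra.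
Qed.

Section Ranked.
Variable r : E -> nat.
Hypothesis r_inj : injective r.

Let S k : {set E} := [set e | (r e < k)%N]%SET.

(** The point found by the greedy algorithm in the order of [r]: each coordinate is a marginal
    value. Ranks may have gaps, where [S] does not grow. *)
Definition greedy g : {ffun E -> R} := [ffun e => g (S (r e).+1) - g (S (r e))].

Let S_bound : exists n, S n = finset.setT.
Proof.
exists (\max_e (r e)).+1; apply/setP => e; rewrite !inE ltnS.
exact: leq_bigmax.
Qed.

Let S_step k : (exists2 e, r e = k & S k.+1 = e |: S k) \/ S k.+1 = S k.
Proof.
case: (pselect (exists e, r e = k)) => [[e re]|nk]; [left; exists e => //|right].
  apply/setP => e'; rewrite !inE ltnS leq_eqVlt -re; congr orb.
  exact: inj_eq.
apply/setP => e; rewrite !inE ltnS leq_eqVlt; case: eqP => //= re.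
by case: nk; exists e.
Qed.

(** Submodularity makes marginal values decrease: joining [e] to [S k] gains at most what joining it
    to [A :&: S k] gains. Induction along the chain [S k] adds this up. *)
Lemma greedy_le g A : polymatroid g -> \sum_(e in A) greedy g e <= g A.
Proof.
move=> hg; have [g0 _ _] := hg.
have [n Sn] := S_bound; rewrite -[A]finset.setIT -Sn; elim: n {Sn} => [|k IH].
  have -> : A :&: S 0 = finset.set0 by apply/setP => e; rewrite !inE ltn0 andbF.
  by rewrite finset.big_set0 g0.
case: (S_step k) => [[e re Se]|->//]; case: (boolP (e \in A)) => eA; last first.
  suff -> : A :&: S k.+1 = A :&: S k by [].
  apply/setP => x; rewrite Se !inE; case: eqP => // ->.
  by rewrite (negbTE eA).
have eS : e \notin S k by rewrite inE re ltnn.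
have -> : A :&: S k.+1 = e |: (A :&: S k).
  apply/setP => x; rewrite Se !inE; case: eqP => // ->; by rewrite eA.
rewrite big_setU1 /=; last by rewrite inE (negbTE eS) andbF.
have := polymatroid_submod (e |: (A :&: S k)) (S k) hg.
have -> : (e |: A :&: S k) :|: S k = S k.+1.
  by apply/setP => x; rewrite Se !inE; case: eqP => //= _; case: (x \in A); case: (r x < k)%N.
have -> : (e |: A :&: S k) :&: S k = A :&: S k.
  apply/setP => x; rewrite !inE; case: eqP => //= [->|_].
    by rewrite re ltnn andbF.
  by rewrite -andbA andbb.
rewrite ffunE re; lra.
Qed.

(** As long as [D :&: S k] grows it equals [S k], so the marginal values telescope. *)
Lemma greedy_eq g D : polymatroid g ->
  (forall e e', e \in D -> (r e' <= r e)%N -> e' \in D) ->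
  \sum_(e in D) greedy g e = g D.
Proof.
move=> [g0 _ _] hD.
have [n Sn] := S_bound; rewrite -[D]finset.setIT -Sn; elim: n {Sn} => [|k IH].
  have -> : D :&: S 0 = finset.set0 by apply/setP => e; rewrite !inE ltn0 andbF.
  by rewrite finset.big_set0 g0.
case: (S_step k) => [[e re Se]|->//]; case: (boolP (e \in D)) => eD; last first.
  suff -> : D :&: S k.+1 = D :&: S k by [].
  apply/setP => x; rewrite Se !inE; case: eqP => // ->.
  by rewrite (negbTE eD).
have DS j : (j <= k.+1)%N -> D :&: S j = S j.
  move=> jk; apply/setP => x; rewrite !inE; case: ltnP; rewrite ?andbT ?andbF // => xj.
  by rewrite (hD e) // re -ltnS (leq_trans xj).
move: IH; rewrite !DS // Se => IH.
rewrite big_setU1 /= ?IH ?ffunE ?re ?Se ?subrK //.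
by rewrite inE re ltnn.
Qed.

Lemma greedy_ge0 g e : polymatroid g -> 0 <= greedy g e.
Proof.
move=> hg; rewrite ffunE subr_ge0; apply: (polymatroid_mono hg).
by apply/fintype.subsetP => x; rewrite !inE => /ltnW.
Qed.

End Ranked.

Lemma decreasing_rank (w : E -> R) :
  exists2 r : E -> nat, injective r & forall e e', w e < w e' -> (r e' < r e)%N.
Proof.
pose l := sort (fun a b => w b <= w a) (enum E).
have lE e : e \in l by rewrite mem_sort mem_enum.
exists (fun e => index e l) => [e e'|e e' wee'].
  by move/(congr1 (nth e l)); rewrite !nth_index.
rewrite ltnNge; apply/negP => ie.
have tr : transitive (fun a b => w b <= w a) by move=> a b c ba ac; exact: le_trans ac ba.
have sl : sorted (fun a b => w b <= w a) l by apply: sort_sorted => a b; exact: le_total.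
have := sorted_leq_nth tr (fun _ => lexx _) e sl.
move=> /(_ (index e l) (index e' l)); rewrite !inE !index_mem !nth_index //.
move=> /(_ (lE e) (lE e') ie).
by rewrite leNgt wee'.
Qed.

End Greedy.

(** * Cells *)
Section Cells.
Variables (R : realType) (E : finType) (f : {set E} -> R).
Local Notation V := {ffun E -> R}.
Local Notation P := (polymatroid_polytope f).
Implicit Types (w x y : V) (A B : {set E}) (a t s : R).

Definition sgt w t : {set E} := [set e | t < w e]%SET.
Definition sge w t : {set E} := [set e | t <= w e]%SET.

Definition tilt w t x : R := dot w x - t * coordsum x.

Lemma tiltE w t x : tilt w t x = \sum_e (w e - t) * x e.
Proof.
rewrite /tilt /dot /coordsum mulr_sumr -sumrB.
by apply: eq_bigr => e _; rewrite mulrBl.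
Qed.

Fact tilt_is_linear w t : scalar (tilt w t).
Proof.
move=> a x y; rewrite !tiltE mulr_sumr -big_split /=.
by apply: eq_bigr => e _; rewrite !ffunE mulrDr mulrCA.
Qed.

HB.instance Definition _ w t :=
  GRing.isLinear.Build R V R *%R (tilt w t) (tilt_is_linear w t).

Definition cell w t : set V := face_max (tilt w t) P.

Definition slope w t := f (sgt w t) < f (sge w t).

Lemma scalarE (u : {scalar V}) : exists w, forall x, u x = dot w x.
Proof.
exists [ffun e => u [ffun e' => (e' == e)%:R]] => x.
have {1}-> : x = \sum_e x e *: ([ffun e' => (e' == e)%:R] : V).
  apply/ffunP => e; rewrite sum_ffunE (bigD1 e) //= !ffunE eqxx.
  rewrite big1 ?addr0 ?[_ *: _]mulr1 // => i ie.
  by rewrite !ffunE eq_sym (negbTE ie) [_ *: _]mulr0.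
rewrite linear_sum; apply: eq_bigr => e _; rewrite linearZ /= ffunE.
by rewrite mulrC.
Qed.

Lemma tilt0 w x : tilt w 0 x = dot w x.
Proof. by rewrite /tilt mul0r subr0. Qed.

Lemma sgt_sub_sge w t : sgt w t \subset sge w t.
Proof. by apply/fintype.subsetP => e; rewrite !inE => /ltW. Qed.

Lemma sgeS w s t : s <= t -> sge w t \subset sge w s.
Proof. by move=> st; apply/fintype.subsetP => e; rewrite !inE; exact: le_trans. Qed.

Lemma sgtS w s t : s <= t -> sgt w t \subset sgt w s.
Proof. by move=> st; apply/fintype.subsetP => e; rewrite !inE; exact: le_lt_trans. Qed.

Lemma sge_sub_sgt w s t : s < t -> sge w t \subset sgt w s.
Proof. by move=> st; apply/fintype.subsetP => e; rewrite !inE; exact: lt_le_trans. Qed.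

Lemma sgt_next w t : sgt w t != finset.set0 ->
  exists2 e, t < w e & sgt w t = sge w (w e).
Proof.
case/set0Pn => e0 e0t.
case: (@arg_minP _ _ _ e0 [pred e | t < w e] (fun e => w e)) => [|e /= et emin].
  by move: e0t; rewrite !inE.
exists e; first exact: et.
apply/setP => e'; rewrite !inE; apply/idP/idP; first exact: emin.
exact: lt_le_trans.
Qed.

Hypothesis hf : polymatroid f.

Let f0 : f finset.set0 = 0. Proof. by case: hf. Qed.
Let fmono A B : A \subset B -> f A <= f B. Proof. exact: polymatroid_mono. Qed.

(** Abel summation: the weighted sum is a sum, over the layers between consecutive values of [w], of
    the layer height times the sum of [x] over a superlevel set. Each such sum is at most its tight
    value, attained by [x0], so equality of the totals forces tightness in every layer. *)
Lemma layer_le w t x x0 : P x ->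
  (forall a, t <= a -> \sum_(e in sgt w a) x0 e = f (sgt w a)) ->
  \sum_(e in sgt w t) (w e - t) * x e <= \sum_(e in sgt w t) (w e - t) * x0 e /\
  (\sum_(e in sgt w t) (w e - t) * x e = \sum_(e in sgt w t) (w e - t) * x0 e ->
    forall a, t <= a -> \sum_(e in sgt w a) x e = f (sgt w a)).
Proof.
move=> Px; move: {2}#|_| (leqnn #|sgt w t|) => n; elim: n t => [|n IH] t.
  rewrite leqn0 cards_eq0 => /eqP st0 _; rewrite st0 !finset.big_set0; split=> // _ a ta.
  have /eqP -> : sgt w a == finset.set0 by rewrite -finset.subset0 -st0 sgtS.
  by rewrite finset.big_set0 f0.
move=> tn h0; case: (eqVneq (sgt w t) finset.set0) => [s0|/sgt_next[e1 te1 se1]].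
  by apply: IH => //; rewrite s0 cards0.
pose t' := w e1.
(* The layer between [t] and the next value [t'] splits off; elements of weight exactly [t'] drop
   out of the sum above it. *)
have split_layer (z : V) : \sum_(e in sgt w t) (w e - t) * z e =
    \sum_(e in sgt w t') (w e - t') * z e + (t' - t) * \sum_(e in sgt w t) z e.
  have -> : \sum_(e in sgt w t') (w e - t') * z e = \sum_(e in sgt w t) (w e - t') * z e.
    rewrite [RHS](big_setID (sgt w t')) /= [X in _ + X]big1 ?addr0.
      apply: eq_bigl => e; rewrite finset.in_setI.
      have [/(fintype.subsetP (sgtS _ (ltW te1))) ->|] := boolP (e \in sgt w t') => //.
      by rewrite andbF.
    move=> e; rewrite se1 !inE -leNgt => /andP[ee1 e1e].
    by rewrite (le_anti (introT andP (conj ee1 e1e))) subrr mul0r.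
  rewrite mulr_sumr -big_split /=; apply: eq_bigr => e _.
  by rewrite -mulrDl addrA subrK.
have [||le1 eq1] := IH t'.
- rewrite -ltnS; apply: leq_trans tn; apply: proper_card; apply/properP; split.
    exact: sgtS (ltW te1).
  by exists e1; rewrite !inE ?ltxx.
- by move=> a ta; apply: h0; exact: le_trans (ltW te1) ta.
have le2 : \sum_(e in sgt w t) x e <= \sum_(e in sgt w t) x0 e.
  by rewrite h0 //; apply: (Px.2).
have t't : 0 < t' - t by rewrite subr_gt0.
have le2' : (t' - t) * \sum_(e in sgt w t) x e <= (t' - t) * \sum_(e in sgt w t) x0 e.
  by rewrite ler_pM2l.
rewrite !split_layer; split; first by rewrite lerD.
move=> eqs a ta; have eq1' := eq1 ltac:(lra) a.
have [/eq1'//|at'] := leP t' a.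
have /(mulfI (lt0r_neq0 t't)) :
  (t' - t) * \sum_(e in sgt w t) x e = (t' - t) * \sum_(e in sgt w t) x0 e by lra.
rewrite h0 //; suff -> : sgt w a = sgt w t by [].
by apply/eqP; rewrite finset.eqEsubset sgtS //= se1; exact: sge_sub_sgt.
Qed.

(** Greedy points of the truncations, ranked by decreasing [w]. Superlevel sets are initial segments
    and get their full truncated value; once [sge w t] exhausts [s], all later coordinates are
    differences [s - s]. *)
Lemma greedy_path w : exists gamma : R -> V,
  (forall e, continuous (fun s => gamma s e)) /\
  forall s, 0 <= s <= f [set: E]%SET ->
  [/\ P (gamma s), coordsum (gamma s) = s,
    forall a, \sum_(e in sgt w a) gamma s e = Num.min s (f (sgt w a)) &
    forall t e, s <= f (sge w t) -> w e < t -> gamma s e = 0].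
Proof.
have [r r_inj rw] := decreasing_rank w.
exists (fun s => greedy r (fun A => Num.min s (f A))); split=> [e|s /andP[s0 sE]].
  rewrite (_ : (fun s => _) = fun s => Num.min s (f [set e' | (r e' < (r e).+1)%N]%SET) -
                             Num.min s (f [set e' | (r e' < r e)%N]%SET)); last first.
    by apply/funext => s; rewrite ffunE.
  by move=> s; apply: cvgB; apply: continuous_min; (exact: cvg_id || exact: cvg_cst).
have hg := polymatroid_trunc hf s0; split.
- split=> [e|A]; first exact: greedy_ge0.
  by apply: (le_trans (greedy_le r_inj A hg)); rewrite ge_min lexx orbT.
- have := greedy_eq r_inj (D := [set: E]%SET) hg (fun _ _ _ _ => finset.in_setT _).
  rewrite min_l // => h; rewrite -[RHS]h.
  by apply: eq_bigl => e; rewrite finset.in_setT.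
- move=> a; apply: greedy_eq => // e e'; rewrite !inE => ae re.
  by apply: (lt_le_trans ae); rewrite leNgt; apply: contraTN re => /rw; rewrite ltnNge.
- move=> t e st et; rewrite ffunE.
  have h k : (r e <= k)%N -> Num.min s (f [set e' | (r e' < k)%N]%SET) = s.
    move=> rk; apply/min_l/(le_trans st)/fmono/fintype.subsetP => e'; rewrite !inE => te'.
    by apply: leq_trans rk; apply/rw/(lt_le_trans et te').
  by rewrite !h ?subrr.
Qed.

Lemma tilt_split w t x : tilt w t x =
  \sum_(e in sgt w t) (w e - t) * x e - \sum_(e | w e < t) (t - w e) * x e.
Proof.
rewrite tiltE (bigID (mem (sgt w t))) /=; congr (_ + _).
rewrite [LHS](bigID (fun e => w e < t)) /= [X in _ + X]big1 ?addr0 => [|e].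
  rewrite -sumrN; apply: eq_big => [e|e _]; last by rewrite -mulNr opprB.
  by rewrite inE -leNgt; case: ltgtP.
by rewrite inE -!leNgt => /le_anti ->; rewrite subrr mul0r.
Qed.

(** The part of [tilt] above [t] is bounded by [layer_le], and the part below [t] contributes at
    most 0. A greedy point attains both bounds at once, so every maximizer attains both. *)
Lemma cellP w t x : cell w t x <->
  [/\ P x, forall a, t <= a -> \sum_(e in sgt w a) x e = f (sgt w a) &
      forall e, w e < t -> x e = 0].
Proof.
have low_ge0 (y : V) e : P y -> w e < t -> 0 <= (t - w e) * y e.
  by move=> Py /ltW et; rewrite mulr_ge0 ?subr_ge0 //; apply: Py.1.
split=> [[Px xmax]|[Px x1 x2]]; last first.
  split=> // y Py; rewrite !tilt_split lerB //.
    by have [] := layer_le Py x1.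
  by rewrite big1 => [|e /x2 ->]; [apply: sumr_ge0 => e; exact: low_ge0|rewrite mulr0].
(* Any total from [f (sgt w t)] to [f (sge w t)] makes the greedy point tight above [t] and zero
   below it; the upper end is taken. *)
have [gamma [_ /(_ (f (sge w t)))]] := greedy_path w.
set x0 := gamma _; case=> [|Px0 _ x01 x02].
  by rewrite (fmono (finset.subsetT _)) andbT; case: hf.
have {}x01 a : t <= a -> \sum_(e in sgt w a) x0 e = f (sgt w a).
  by move=> ta; rewrite x01 min_r // fmono // (fintype.subset_trans (sgtS w ta)) // sgt_sub_sge.
have [le1 eq1] := layer_le Px x01.
have lowx : 0 <= \sum_(e | w e < t) (t - w e) * x e by apply: sumr_ge0 => e; exact: low_ge0.
have := xmax _ Px0; rewrite !tilt_split [X in _ - X <= _]big1 => [|e /x02 -> //]; last first.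
  by rewrite mulr0.
rewrite subr0 => h; split=> //; first by apply: eq1; lra.
move=> e et; have /eqP : \sum_(e | w e < t) (t - w e) * x e = 0 by lra.
rewrite psumr_eq0 => [/allP/(_ e)|e' ?]; last exact: low_ge0.
rewrite mem_index_enum et => /(_ isT) /implyP/(_ isT).
by rewrite mulf_eq0 subr_eq0 gt_eqF //= => /eqP.
Qed.

End Cells.

(** * Ranges, slices and ends of cells *)

Section CellGeometry.
Variables (R : realType) (E : finType) (f : {set E} -> R).
Hypothesis hf : polymatroid f.
Local Notation V := {ffun E -> R}.
Local Notation P := (polymatroid_polytope f).
Local Notation cell := (cell f).
Local Notation slope := (slope f).
Implicit Types (w x y : V) (A B : {set E}) (a t s : R).

Let f0 : f finset.set0 = 0. Proof. by case: hf. Qed.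
Let fge0 A : 0 <= f A. Proof. by case: hf. Qed.
Let fmono A B : A \subset B -> f A <= f B. Proof. exact: polymatroid_mono. Qed.
Let fT A : f A <= f [set: E]%SET. Proof. exact/fmono/finset.subsetT. Qed.

Lemma coordsum_sub A x :
  coordsum x = \sum_(e in A) x e + \sum_(e in ~: A) x e.
Proof.
rewrite /coordsum (bigID (mem A)) /=; congr (_ + _).
by apply: eq_bigl => e; rewrite finset.in_setC.
Qed.

Lemma polytope_range x : P x -> 0 <= coordsum x <= f [set: E]%SET.
Proof.
move=> [x0 xf]; rewrite sumr_ge0 //=; apply: le_trans (xf _).
by rewrite le_eqVlt; apply/orP; left; apply/eqP/eq_bigl => e; rewrite finset.in_setT.
Qed.

Lemma sum_sub_le A B x : P x -> A \subset B -> \sum_(e in A) x e <= \sum_(e in B) x e.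
Proof.
move=> [x0 _] /fintype.subsetP AB; rewrite [leRHS](bigID (mem A)) /=.
rewrite -[leLHS]addr0 lerD ?sumr_ge0 //.
rewrite le_eqVlt; apply/orP; left; apply/eqP/eq_bigl => e.
by case: (boolP (e \in A)) => [/AB ->|]; rewrite ?andbF.
Qed.

Lemma cell_range w t x : cell w t x -> f (sgt w t) <= coordsum x <= f (sge w t).
Proof.
move=> /(cellP hf)[Px xt x0]; rewrite -(xt t) //; apply/andP; split.
  rewrite (coordsum_sub (sgt w t)) lerDl; apply: sumr_ge0 => e _; exact: Px.1.
rewrite (coordsum_sub (sge w t)) [X in _ + X]big1 => [|e]; last first.
  by rewrite !inE -ltNge; exact: x0.
by rewrite addr0; apply: Px.2.
Qed.

(** On a slice of constant coordinate sum [tilt w t] and [dot w] differ by a constant, so points of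
    a cell maximize [w] in their slices. *)
Lemma slice_le w t x y :
  P x -> cell w t y -> coordsum x = coordsum y -> dot w x <= dot w y.
Proof. by move=> Px [_ /(_ _ Px) h] cxy; move: h; rewrite /tilt cxy lerD2r. Qed.

Lemma slice_eq w t x y : P x -> cell w t y -> coordsum x = coordsum y ->
  dot w x = dot w y -> cell w t x.
Proof.
move=> Px [Py ymax] cxy dxy; split=> // z Pz.
by rewrite /tilt cxy dxy; exact: ymax.
Qed.

(** The greedy path serves all levels at once: it shows that the ranges of the cells are attained,
    and it yields a section along the whole string. *)
Lemma cell_section w : exists gamma : R -> V,
  (forall e, continuous (fun s => gamma s e)) /\
  forall s, 0 <= s <= f [set: E]%SET ->
  [/\ P (gamma s), coordsum (gamma s) = s &
    forall t, f (sgt w t) <= s <= f (sge w t) -> cell w t (gamma s)].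
Proof.
have [gamma [gcont hg]] := greedy_path hf w.
exists gamma; split=> // s /hg[Pg cg g1 g2]; split=> // t /andP[ts st].
apply/(cellP hf); split=> // [a ta|e]; last exact: g2.
by rewrite g1 min_r // (le_trans _ ts) // fmono // sgtS.
Qed.

Lemma cell_point w t s : f (sgt w t) <= s <= f (sge w t) ->
  exists2 x, cell w t x & coordsum x = s.
Proof.
move=> /andP[ts st]; have [gamma [_ /(_ s)]] := cell_section w.
case=> [|_ cg /(_ t)]; first by rewrite (le_trans _ ts) // (le_trans st).
by rewrite ts st => /(_ isT); exists (gamma s).
Qed.

(** Within the range of [t], membership in [cell w t] only asks for [w]-maximality in the slice,
    which [x] has from [cell w t']. *)
Lemma cell_slice w t t' x : cell w t' x -> f (sgt w t) <= coordsum x <= f (sge w t) ->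
  cell w t x.
Proof.
move=> xt' /cell_point[y yt cyx]; apply: (slice_eq xt'.1 yt) => //.
apply/le_anti/andP; split; first exact: slice_le xt'.1 yt _.
exact: slice_le yt.1 xt' _.
Qed.

Lemma sgt_le_sge w t : f (sgt w t) <= f (sge w t).
Proof. exact/fmono/sgt_sub_sge. Qed.

Lemma cell_minE w t x :
  face_min coordsum (cell w t) x <-> cell w t x /\ coordsum x = f (sgt w t).
Proof.
split=> [[xt xmin]|[xt cx]]; split=> //.
  have [|y yt cy] := @cell_point w t (f (sgt w t)); first by rewrite lexx sgt_le_sge.
  by apply/le_anti; rewrite -{1}cy xmin //=; case/andP: (cell_range xt).
by move=> y /cell_range/andP[]; rewrite cx.
Qed.

Lemma cell_maxE w t x :
  face_max coordsum (cell w t) x <-> cell w t x /\ coordsum x = f (sge w t).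
Proof.
split=> [[xt xmax]|[xt cx]]; split=> //.
  have [|y yt cy] := @cell_point w t (f (sge w t)); first by rewrite lexx sgt_le_sge.
  by apply/le_anti; rewrite -{2}cy xmax // andbT; case/andP: (cell_range xt).
by move=> y /cell_range/andP[]; rewrite cx.
Qed.

Lemma cell_face w t : is_face P (cell w t).
Proof.
split; last by exists (tilt w t).
have [|x xt _] := @cell_point w t (f (sgt w t)); last by exists x.
by rewrite lexx sgt_le_sge.
Qed.

Lemma slope_nonconstant w t : slope w t <-> nonconstant_on coordsum (cell w t).
Proof.
split=> [st|[x [y [/cell_range/andP[x1 x2] /cell_range/andP[y1 y2]]]]].
  have [|x xt cx] := @cell_point w t (f (sgt w t)); first by rewrite lexx sgt_le_sge.
  have [|y yt cy] := @cell_point w t (f (sge w t)); first by rewrite lexx sgt_le_sge.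
  by exists x, y; split=> //; rewrite cx cy; apply/eqP; rewrite lt_eqF.
rewrite /slope => cxy; rewrite lt_neqAle sgt_le_sge andbT; apply/eqP => ee; apply: cxy; lra.
Qed.

(** Take the largest value [t] of [w] with [q (f (sge w t))]. Then [sgt w t] is empty or the weak
    superlevel set of a larger value, and [q] fails there. *)
Lemma jump w (q : pred R) : q (f [set: E]%SET) -> ~~ q 0 ->
  exists t, ~~ q (f (sgt w t)) /\ q (f (sge w t)).
Proof.
move=> qE q0; case: (pselect (exists e : E, true)) => [[e1 _]|E0]; last first.
  have : [set: E]%SET = finset.set0 by apply/setP => e; case: E0; exists e.
  by move=> EE; move: qE q0; rewrite EE f0 => ->.
have [e0 _ e0min] := @arg_minP _ _ _ e1 predT (fun e => w e) isT.
case: (@arg_maxP _ _ _ e0 [pred e | q (f (sge w (w e)))] (fun e => w e)) => [|e /= qe emax].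
  rewrite /= (_ : sge w (w e0) = [set: E]%SET) //; apply/setP => e.
  by rewrite !inE e0min.
exists (w e); split=> //; have [->|/sgt_next[e' ee' ->]] := eqVneq (sgt w (w e)) finset.set0.
  by rewrite f0.
by apply: contraL ee' => /emax; rewrite -leNgt.
Qed.

(** A gap between the two values would be crossed by a jump of [f] along the superlevel sets, at a
    slope strictly between [t'] and [t]. *)
Lemma consecutive w t' t : t' < t ->
  (forall t'', slope w t'' -> ~~ (t' < t'' < t)) -> f (sge w t) = f (sgt w t').
Proof.
move=> tt' nt; apply/le_anti/andP; split; first by apply/fmono/sge_sub_sgt.
rewrite leNgt; apply/negP => lt.
have [||s [/=]] := @jump w (fun v => f (sge w t) < v).
- exact: lt_le_trans lt (fT _).
- by rewrite -leNgt.
rewrite -leNgt => st ts; have /negP := nt s (le_lt_trans st ts); apply.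
apply/andP; split; rewrite ltNge; apply/negP => h.
  by have := fmono (sgtS w h); lra.
by have := fmono (sgeS w h); lra.
Qed.

(** Ranges of consecutive slopes share an endpoint; this half-open form selects the range above it,
    [slope_upper] the one below. *)
Lemma slope_lower w s : 0 <= s < f [set: E]%SET ->
  exists2 t, slope w t & f (sgt w t) <= s < f (sge w t).
Proof.
move=> /andP[s0 sE]; have [||t [/= ]] := @jump w (fun v => s < v) => //.
  by rewrite -leNgt.
by rewrite -leNgt => h1 h2; exists t; [exact: le_lt_trans h1 h2|rewrite h1].
Qed.

Lemma slope_upper w s : 0 < s <= f [set: E]%SET ->
  exists2 t, slope w t & f (sgt w t) < s <= f (sge w t).
Proof.
move=> /andP[s0 sE]; have [||t [/= ]] := @jump w (fun v => s <= v) => //.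
  by rewrite -ltNge.
by rewrite -ltNge => h1 h2; exists t; [exact: lt_le_trans h1 h2|rewrite h1].
Qed.

Lemma slope_order w t t' : slope w t -> slope w t' ->
  f (sgt w t) < f (sge w t') -> t' <= t.
Proof.
by move=> st st'; apply: contraTT; rewrite -!ltNge -leNgt => h; apply/fmono/sge_sub_sgt.
Qed.

(** Only values of [w] can be slopes, since elsewhere [sgt] and [sge] agree. The order is decreasing
    because the coordinate sum grows as the level falls. *)
Definition slopes w : seq R :=
  rev (sort <=%R [seq t <- undup (codom w) | slope w t]).

Lemma mem_slopes w t : (t \in slopes w) = slope w t.
Proof.
rewrite mem_rev mem_sort mem_filter mem_undup; case: (boolP (slope w t)) => //= st.
apply/negPn/negP => tw; move: st; rewrite /slope (_ : sgt w t = sge w t) ?ltxx //.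
apply/setP => e; rewrite !inE lt_def; case: eqP => //= wet.
by rewrite -wet codom_f in tw.
Qed.

Lemma slopes_sorted w : sorted (fun a b => b < a) (slopes w).
Proof.
by rewrite rev_sorted sort_lt_sorted filter_uniq // undup_uniq.
Qed.

Definition string w : seq (set V) := [seq cell w t | t <- slopes w].

End CellGeometry.

(** * Strings of cells *)
Section DecreasingSequences.
Variable R : realType.
Implicit Types t : R.

Lemma gt_transitive : transitive (fun a b : R => b < a).
Proof. by move=> a b c ba ac; exact: lt_trans ac ba. Qed.

Lemma decreasing_bounds t0 (T : seq R) t :
  path (fun a b => b < a) t0 T -> t \in t0 :: T -> last t0 T <= t <= t0.
Proof.
elim: T t0 t => [|t1 T IH] t0 t /=; first by rewrite inE => _ /eqP ->; rewrite lexx.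
move=> /andP[t10 /IH{}IH]; rewrite inE => /orP[/eqP ->|/IH /andP[-> tt1]]; last first.
  exact: le_trans tt1 (ltW t10).
rewrite lexx andbT; have /andP[h _] := IH t1 (mem_head _ _).
exact: le_trans h (ltW t10).
Qed.

Lemma decreasing_nth (T : seq R) i j : sorted (fun a b => b < a) T ->
  (i < j < size T)%N -> nth 0 T j < nth 0 T i.
Proof.
move=> sT /andP[ij jT].
by apply: (sorted_ltn_nth (@gt_transitive) 0 sT) => //; rewrite inE ?(ltn_trans ij).
Qed.

(** Keys weakly decrease along [l], so each class is a contiguous block. This cuts a string into the
    blocks that replace the cells of a coarser one. *)
Lemma flatten_classes (T : eqType) (k : T -> R) (l : seq T) (l' : seq R) :
  sorted (fun a b => b < a) l' -> {in l, forall x, k x \in l'} ->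
  pairwise (fun x y => k y <= k x) l ->
  flatten [seq [seq x <- l | k x == y] | y <- l'] = l.
Proof.
elim: l' l => [|y l' IH] l.
  by case: l => // x l _ /(_ x (mem_head _ _)); rewrite in_nil.
move=> sl' kl pl /=.
have y_max x : x \in l -> k x <= y.
  by move=> /kl /(decreasing_bounds sl')/andP[].
(* The largest key [y] can only occur in a prefix of [l]. *)
have split_l : [seq x <- l | k x == y] ++ [seq x <- l | k x != y] = l.
  elim: l {kl IH} pl y_max => //= x l IH /andP[xl pl] y_max.
  have IHl := IH pl (fun z zl => y_max z (mem_behead (s := x :: l) zl)).
  case: eqVneq => [kx|kx] /=; first by rewrite IHl.
  have kxl z : z \in l -> k z == y = false.
    move=> zl; apply/negbTE; rewrite lt_eqF // (le_lt_trans (allP xl _ zl)) //.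
    by rewrite lt_neqAle kx y_max // mem_head.
  rewrite (eq_in_filter (a2 := pred0)) // filter_pred0 /=.
  rewrite (eq_in_filter (a2 := predT)) ?filter_predT // => z zl.
  by rewrite kxl.
rewrite -[RHS]split_l; congr cat; rewrite -[RHS]IH.
- congr flatten; apply/eq_in_map => z zl'; rewrite -filter_predI; apply: eq_filter => x /=.
  case: (eqVneq (k x) z) => //= ->; rewrite lt_eqF //.
  by move: sl' => /= /(order_path_min (@gt_transitive))/allP/(_ _ zl').
- exact: path_sorted sl'.
- move=> x; rewrite mem_filter => /andP[/negbTE kx /kl]; rewrite inE kx.
  by [].
- exact: pairwise_filter.
Qed.

End DecreasingSequences.

(** * Cells of decreasing slopes form cellular strings *)

Section Strings.
Variables (R : realType) (E : finType) (f : {set E} -> R).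
Hypothesis hf : polymatroid f.
Local Notation V := {ffun E -> R}.
Local Notation P := (polymatroid_polytope f).
Local Notation cell := (cell f).
Local Notation slope := (slope f).
Local Notation slopes := (slopes f).
Local Notation string := (string f).
Implicit Types (w x y : V) (A B : {set E}) (a t s : R).

Let fmono A B : A \subset B -> f A <= f B. Proof. exact: polymatroid_mono. Qed.

(** Shared points have the shared endpoint as coordinate sum; conversely [cell_slice] moves a point
    of either cell with that sum into the other. *)
Lemma consecutive_cells w t t' : f (sge w t) = f (sgt w t') ->
  face_max coordsum (cell w t) = cell w t `&` cell w t' /\
  cell w t `&` cell w t' = face_min coordsum (cell w t').
Proof.
move=> ett; split; apply/seteqP; split=> x.
- move/(cell_maxE hf) => [xt cx]; split=> //; apply: (cell_slice hf xt).
  by rewrite cx ett lexx sgt_le_sge.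
- move=> [xt xt']; apply/(cell_maxE hf); split=> //; apply/le_anti.
  have /andP[_ ->] := cell_range hf xt; rewrite ett.
  by case/andP: (cell_range hf xt').
- move=> [xt xt']; apply/(cell_minE hf); split=> //; apply/le_anti.
  have /andP[-> _] := cell_range hf xt'; rewrite -ett.
  by case/andP: (cell_range hf xt) => _ ->.
- move/(cell_minE hf) => [xt cx]; split=> //; apply: (cell_slice hf xt).
  by rewrite cx -ett lexx sgt_le_sge.
Qed.

(** Covers two cases: all slopes of [w] with [G] the polytope, and the slopes belonging to one cell
    [G] of another weight. The condition on intermediate slopes makes neighbours in [T] consecutive
    slopes of [w]. *)
Lemma cellular_sublist w (G : set V) (T : seq R) :
  sorted (fun a b => b < a) T -> T <> [::] ->
  (forall t, t \in T -> slope w t /\ is_face G (cell w t)) ->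
  (forall t1 t2 t, t1 \in T -> t2 \in T -> slope w t -> t2 < t < t1 -> t \in T) ->
  (forall x, G x -> f (sgt w (head 0 T)) <= coordsum x <= f (sge w (last 0 T))) ->
  cellular_string G coordsum [seq cell w t | t <- T].
Proof.
move=> sT T0 hT conv rangeG.
have cellG t : t \in T -> cell w t `<=` G.
  by move=> /hT[_ [_ [u ->]]] x [].
split.
- by case: T T0 {sT hT conv rangeG cellG}.
- move=> i; rewrite size_map => iT; rewrite (nth_map 0) //.
  by have [/(slope_nonconstant hf) ? ?] := hT _ (mem_nth 0 iT).
- case: T T0 sT hT conv rangeG cellG => // t T _ _ hT _ rangeG cellG /= x.
  move=> /(cell_minE hf)[xt cx]; split=> [|y /rangeG/andP[]]; last by rewrite cx.
  by apply: cellG xt; rewrite mem_head.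
- case: T T0 sT hT conv rangeG cellG => // t T _ _ hT _ rangeG cellG /= x.
  rewrite last_map => /(cell_maxE hf)[xt cx]; split=> [|y /rangeG/andP[_]]; last by rewrite cx.
  by apply: cellG xt; exact: mem_last.
- move=> i; rewrite size_map => iT; rewrite !(nth_map 0) ?(ltnW iT) //.
  apply: consecutive_cells; apply: consecutive => //.
    by apply: decreasing_nth => //; rewrite ltnSn.
  move=> t st; apply/negP => tb.
  have /(nthP 0)[j jT tj] := conv _ _ _ (mem_nth 0 (ltnW iT)) (mem_nth 0 iT) st tb.
  case/andP: tb; rewrite -tj; case: (ltngtP j i) => [ji|ij|->]; last by rewrite ltxx.
    have := @decreasing_nth R T j i sT; rewrite ji ltnW // => /(_ isT); lra.
  case: (eqVneq j i.+1) => [->|ji]; first by rewrite ltxx.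
  have := @decreasing_nth R T i.+1 j sT; rewrite jT andbT ltn_neqAle eq_sym ji ij.
  move=> /(_ isT); lra.
Qed.

Hypothesis hfE : 0 < f [set: E]%SET.

Lemma slopes_neq0 w : slopes w <> [::].
Proof.
have [|t + _] := @slope_lower _ _ _ hf w 0; first by rewrite lexx.
by rewrite -mem_slopes => + eT; rewrite eT.
Qed.

Lemma string_cellular w : cellular_string P coordsum (string w).
Proof.
apply: cellular_sublist => //.
- exact: slopes_sorted.
- exact: slopes_neq0.
- by move=> t; rewrite mem_slopes // => st; split=> //; exact: cell_face.
- by move=> t1 t2 t _ _; rewrite mem_slopes.
move=> x /polytope_range /andP[x0 xE].
have := slopes_sorted f w; have := @slopes_neq0 w; have := mem_slopes f w.
case: (slopes w) => // t0 T mT _ /= pT; apply/andP; split.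
  apply: le_trans x0; have [|t] := @slope_lower _ _ _ hf w 0; first by rewrite lexx.
  rewrite -mT // => /(decreasing_bounds pT)/andP[_ tt0] /andP[+ _].
  by apply: le_trans; apply/fmono/sgtS.
apply: (le_trans xE); have [|t] := @slope_upper _ _ _ hf w (f [set: E]%SET).
  by rewrite hfE lexx.
rewrite -mT // => /(decreasing_bounds pT)/andP[tt0 _] /andP[_ h].
by apply: (le_trans h); apply/fmono/sgeS.
Qed.

End Strings.

(** * Recovering a weight from a cellular string *)

Section EveryStringIsCoherent.
Variables (R : realType) (E : finType) (f : {set E} -> R).
Hypothesis hf : polymatroid f.
Local Notation V := {ffun E -> R}.
Local Notation P := (polymatroid_polytope f).
Local Notation cell := (cell f).
Local Notation slope := (slope f).
Local Notation slopes := (slopes f).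
Local Notation string := (string f).
Implicit Types (w u x y : V) (A B : {set E}) (a t s : R).

Let f0 : f finset.set0 = 0. Proof. by case: hf. Qed.

Definition restrict A x : V := [ffun e => if e \in A then x e else 0].

Lemma sum_restrict A B x :
  \sum_(e in B) restrict A x e = \sum_(e in B :&: A) x e.
Proof.
rewrite (big_setID A) /= [X in _ + X]big1 ?addr0 => [|e]; last first.
  by rewrite finset.in_setD ffunE => /andP[/negbTE ->].
by apply: eq_bigr => e; rewrite finset.in_setI ffunE => /andP[_ ->].
Qed.

Lemma coordsum_restrict A x : coordsum (restrict A x) = \sum_(e in A) x e.
Proof.
rewrite (coordsum_sub A) sum_restrict finset.setIid.
rewrite [X in _ + X]big1 ?addr0 // => e.
by rewrite finset.in_setC ffunE => /negbTE ->.
Qed.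

Lemma polytope_restrict A x : P x -> P (restrict A x).
Proof.
move=> Px; split=> [e|B]; first by rewrite ffunE; case: ifP => // _; apply: Px.1.
by rewrite sum_restrict; apply: le_trans (Px.2 B); apply/(sum_sub_le Px)/finset.subsetIl.
Qed.

Lemma nonneg_sum0 A x e : P x -> \sum_(i in A) x i = 0 -> e \in A -> x e = 0.
Proof.
move=> [x0 _] /eqP; rewrite psumr_eq0 // => /allP/(_ e).
by rewrite mem_index_enum => /(_ isT)/implyP + eA => /(_ eA)/eqP.
Qed.

Lemma cell_min_support w t x e :
  face_min coordsum (cell w t) x -> e \notin sgt w t -> x e = 0.
Proof.
move=> /(cell_minE hf)[/(cellP hf)[Px /(_ t (lexx _)) xt _]].
rewrite (coordsum_sub (sgt w t)) xt -[X in _ = X]addr0 => /addrI x0 et.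
by apply: (nonneg_sum0 Px x0); rewrite finset.in_setC.
Qed.

Lemma cell_restrict w t x :
  cell w t x -> face_min coordsum (cell w t) (restrict (sgt w t) x).
Proof.
move=> /(cellP hf)[Px xt x0]; apply/(cell_minE hf).
rewrite coordsum_restrict xt //; split=> //; apply/(cellP hf); split.
- exact: polytope_restrict.
- by move=> a ta; rewrite sum_restrict (finset.setIidPl (sgtS w ta)) xt.
- by move=> e et; rewrite ffunE x0 // if_same.
Qed.

(** Converse of [cell_restrict]: a cell is recovered from the restrictions to [sgt w t], which form
    its minimal face, and the condition of vanishing where [w e < t]. *)
Lemma cell_of_restrict w t x : P x -> cell w t (restrict (sgt w t) x) ->
  (forall e, w e < t -> x e = 0) -> cell w t x.
Proof.
move=> Px /(cellP hf)[_ xt _] x0; apply/(cellP hf); split=> // a ta.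
by rewrite -xt // sum_restrict (finset.setIidPl (sgtS w ta)).
Qed.

(** Equal minimal faces do not force equal sets [sgt], but they make the coordinates on the
    symmetric difference vanish, so either set may be used for restricting. *)
Lemma restrict_swap u w t' t x :
  face_min coordsum (cell u t') = face_min coordsum (cell w t) -> P x ->
  face_min coordsum (cell u t') (restrict (sgt u t') x) ->
  (forall e, (e \in sgt u t') != (e \in sgt w t) -> x e = 0) /\
  restrict (sgt w t) x = restrict (sgt u t') x.
Proof.
set A := sgt u t'; set C := sgt w t => eK Px zK; set z := restrict A x in zK *.
have zK' := zK; rewrite eK in zK'.
have /(cell_minE hf)[_] := zK'; rewrite -/C => cz.
have z0 e : e \notin C -> z e = 0 by exact: cell_min_support.
(* The restriction to [A] already has sum [f C] inside [C], which leaves nothing for [C :\: A] under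
   the bound [f C]. *)
have sC : \sum_(e in C :\: A) x e = 0.
  have h := Px.2 C; move: cz; rewrite (coordsum_sub C) sum_restrict.
  rewrite [X in _ + X]big1 => [|e]; last by rewrite finset.in_setC => /z0.
  move: h; rewrite (big_setID A) /= => h cz.
  apply/le_anti; rewrite sumr_ge0 ?andbT => [|e _]; last exact: Px.1.
  by lra.
have xAC e : (e \in A) != (e \in C) -> x e = 0.
  case: (boolP (e \in A)) => eA; case: (boolP (e \in C)) => eC // _.
    by have := z0 _ eC; rewrite ffunE eA.
  by apply: (nonneg_sum0 Px sC); rewrite finset.in_setD eA eC.
split=> //; apply/ffunP => e; rewrite !ffunE.
by have := xAC e; case: (e \in A); case: (e \in C) => //= /(_ isT) ->.
Qed.

(** Outside [sgt w t] both cells allow the same coordinates to be nonzero; inside, [restrict_swap]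
    identifies the restrictions. This trades the functional of a single face for the common weight
    [w]. *)
Lemma cell_extend u w t' t :
  face_min coordsum (cell u t') = face_min coordsum (cell w t) ->
  sge w t = sgt w t :|: sge u t' -> cell u t' = cell w t.
Proof.
move=> eK /setP eS; apply/seteqP; split=> x xc; have := xc; move=> /(cellP hf)[Px _ x0].
  have xK := cell_restrict xc; have [xd xr] := restrict_swap eK Px xK.
  apply: cell_of_restrict => //; first by rewrite xr; move: xK; rewrite eK => -[].
  move=> e et; have := eS e; rewrite !inE leNgt et /= => /esym/norP[_].
  by rewrite -ltNge => /x0.
have xK := cell_restrict xc; have [xd xr] := restrict_swap (esym eK) Px xK.
apply: cell_of_restrict => //; first by rewrite xr; move: xK; rewrite -eK => -[].
move=> e et; case: (boolP (e \in sgt w t)) => ew.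
  by apply: xd; rewrite ew inE -leNgt ltW.
apply: x0; rewrite ltNge; apply/negP => te; have := eS e.
by move: ew; rewrite !inE te => /negbTE -> /esym; rewrite leNgt et.
Qed.

Lemma cell_min0 w t : f (sgt w t) = 0 -> face_min coordsum (cell w t) = [set 0].
Proof.
move=> ft; have x0 x : face_min coordsum (cell w t) x -> x = 0.
  move=> /(cell_minE hf)[xt]; rewrite ft (coordsum_sub [set: E]%SET).
  rewrite [X in _ + X]big1 ?addr0 => [cx|e]; last by rewrite !inE.
  apply/ffunP => e; rewrite [RHS]ffunE; apply: (nonneg_sum0 xt.1 cx).
  exact: finset.in_setT.
apply/seteqP; split=> x; first exact: x0.
have [|y yt cy] := @cell_point _ _ _ hf w t (f (sgt w t)); first by rewrite lexx sgt_le_sge.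
have /[dup] /x0 -> : face_min coordsum (cell w t) y by apply/(cell_minE hf).
by move=> ? ->.
Qed.

Hypothesis hfE : 0 < f [set: E]%SET.

Lemma cellular_stringP (s : seq (set V)) :
  cellular_string P coordsum s -> exists w, s = string w.
Proof.
move=> [s0 sface shead slast scons]; pose n := size s.
have n_gt0 : (0 < n)%N by rewrite lt0n size_eq0; apply/eqP.
have /choice[u su] i : exists v, (i < n)%N -> nth set0 s i = cell v 0.
  case: (ltnP i n) => [/sface[[_ [v ->]] _]|]; last by exists 0.
  have [w vw] := scalarE v; exists w => _; rewrite /cell /=.
  by congr face_max; apply/funext => x; rewrite vw tilt0.
(* The first index whose functional is nonnegative at [e], or [n] if there is none. The sign in [w]
   gives earlier indices higher levels. *)
pose k e := find (fun i => 0 <= u i e) (iota 0 n).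
pose w : V := [ffun e => - (k e)%:R].
have kn e : (k e <= n)%N by rewrite -[n in (_ <= n)%N](size_iota 0 n) find_size.
have sgeE i e : (e \in sge w (- i%:R)) = (k e <= i)%N.
  by rewrite inE ffunE lerN2 ler_nat.
have sgtE i e : (e \in sgt w (- i%:R)) = (k e < i)%N.
  by rewrite inE ffunE ltrN2 ltr_nat.
have sge_sgt i : sge w (- i%:R) = sgt w (- i.+1%:R).
  by apply/setP => e; rewrite sgeE sgtE.
have sgeU i : (i < n)%N -> sge w (- i%:R) = sgt w (- i%:R) :|: sge (u i) 0.
  move=> i_n; apply/setP => e; rewrite finset.in_setU sgeE sgtE [in X in _ || X]inE.
  rewrite leq_eqVlt orbC; case: ltnP => //= ik; apply/eqP/idP => [ki|ui].
    have : has (fun i => 0 <= u i e) (iota 0 n) by rewrite has_find size_iota -/(k e) ki.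
    by move/(nth_find 0); rewrite -/(k e) ki nth_iota.
  apply/eqP; rewrite eqn_leq ik andbT leqNgt; apply/negP => /(before_find 0).
  by rewrite nth_iota // add0n ui.
(* Both chains start at the minimal face consisting of 0. Afterwards each minimal face is the
   previous maximal face: on the side of the string by cellularity, on the side of [w] because level
   [- i] ends where level [- i.+1] begins. *)
have sE i : (i < n)%N -> nth set0 s i = cell w (- i%:R).
  elim: i => [|i IH] i_n; rewrite su //; apply: cell_extend; rewrite ?sgeU //.
    have wt0 : f (sgt w (- 0%:R)) = 0.
      by rewrite (_ : sgt _ _ = finset.set0) //; apply/setP => e; rewrite sgtE inE.
    rewrite (cell_min0 wt0); apply: cell_min0.
    have [|y yt cy] := @cell_point _ _ _ hf (u 0%N) 0 (f (sgt (u 0%N) 0)).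
      by rewrite lexx sgt_le_sge.
    have /shead[Py ymin] : face_min coordsum (head set0 s) y.
      by rewrite -nth0 su //; apply/(cell_minE hf).
    have P0 : P 0.
      by split=> [e|A]; rewrite ?big1 ?ffunE // => [|e _]; [case: hf|rewrite ffunE].
    have c0 : coordsum (0 : V) = 0 by exact: linear0.
    have : coordsum y <= 0 by rewrite -c0; exact: ymin _ P0.
    by rewrite cy => fu; case: hf => _ fge0 _; apply/le_anti; rewrite fu fge0.
  have [e1 e2] := scons i i_n; rewrite -su // -e2 -e1 IH ?(ltnW i_n) //.
  have := @consecutive_cells _ _ _ hf w (- i%:R) (- i.+1%:R).
  by rewrite sge_sgt => /(_ erefl)[-> ->].
have iota_sorted : sorted (fun a b => b < a) [seq - i%:R : R | i <- iota 0 n].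
  rewrite sorted_map; apply: (@sub_sorted _ ltn); last exact: iota_ltn_sorted.
  by move=> i j; rewrite /= ltrN2 ltr_nat.
have slopesE : slopes w = [seq - i%:R : R | i <- iota 0 n].
  apply: (irr_sorted_eq _ _ (slopes_sorted f w) iota_sorted) => [a b c ba ac|a|t].
  - exact: lt_trans ac ba.
  - by rewrite ltxx.
  rewrite mem_slopes; apply/idP/mapP => [st|[i]]; last first.
    rewrite mem_iota add0n => /andP[_ i_n] ->; apply/(slope_nonconstant hf).
    by rewrite -sE //; case: (sface i i_n).
  have [e we] : exists e, w e = t.
    apply: contrapT => nw; move: st; rewrite /slope (_ : sgt w t = sge w t) ?ltxx //.
    apply/setP => e; rewrite !inE lt_def; case: eqP => //= wt.
    by case: nw; exists e.
  exists (k e); last by rewrite -we ffunE.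
  (* The value [k e = n] gives no slope: the last face of the string already reaches the maximal
     coordinate sum, so [f] cannot grow past level [- n.-1]. *)
  rewrite mem_iota add0n ltn_neqAle kn andbT /=; apply/negP => /eqP ken.
  move: st; rewrite -we ffunE ken /slope ltNge => /negP; apply.
  apply: (le_trans (polymatroid_mono hf (finset.subsetT _))).
  rewrite -(prednK n_gt0) -sge_sgt.
  have [|y yt cy] := @cell_point _ _ _ hf w (- n.-1%:R) (f (sge w (- n.-1%:R))).
    by rewrite lexx sgt_le_sge.
  have [|Py ymax] := slast y.
    by rewrite -nth_last sE ?prednK //; apply/(cell_maxE hf).
  have [gamma [_ /(_ (f [set: E]%SET))]] := cell_section hf w.
  case=> [|/ymax h cg _]; first by rewrite ltW ?lexx.
  by rewrite -{1}cg -cy; exact: h.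
exists w; rewrite (_ : string w = [seq cell w t | t <- slopes w]) // slopesE.
apply: (@eq_from_nth _ set0) => [|i i_n]; first by rewrite !size_map size_iota.
rewrite sE // (nth_map 0) ?size_map ?size_iota //.
by rewrite (nth_map 0%N) ?size_iota // nth_iota.
Qed.

End EveryStringIsCoherent.

(** * Coherence *)
Section FaceConvexity.
Variables (R : realType) (V : lmodType R).
Implicit Types (P : set V) (u : {scalar V}).

Definition is_convex P : Prop := forall x y (a : R),
  P x -> P y -> 0 <= a <= 1 -> P (a *: x + (1 - a) *: y).

Lemma scalar_conv u (a : R) x y : u (a *: x + (1 - a) *: y) = a * u x + (1 - a) * u y.
Proof. by rewrite linearD !linearZ. Qed.

Lemma face_max_convex u P : is_convex P -> is_convex (face_max u P).
Proof.
move=> cP x y a [Px xmax] [Py ymax] a01; split=> [|z Pz]; first exact: cP.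
have := xmax _ Pz; have := ymax _ Pz; rewrite scalar_conv; move: a01 => /andP[a0 a1].
by move=> h1 h2; nra.
Qed.

(** If [u x] were below the maximum, its positive weight would pull the combination below it as
    well. *)
Lemma face_max_absorb u P x y (a : R) : P x -> P y -> 0 < a <= 1 ->
  face_max u P (a *: x + (1 - a) *: y) -> face_max u P x.
Proof.
move=> Px Py /andP[a0 a1] [_ h]; split=> // z Pz; apply: (le_trans (h _ Pz)).
have := h _ Py; rewrite scalar_conv => h1; have := h _ Px; rewrite scalar_conv => h2.
by move: a1; rewrite le_eqVlt => /orP[/eqP ->|a1]; [lra|nra].
Qed.

End FaceConvexity.

(** * Upper edges of the shadow are the shadows of cells *)

Section Coherence.
Variables (R : realType) (E : finType) (f : {set E} -> R).
Hypothesis hf : polymatroid f.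
Local Notation V := {ffun E -> R}.
Local Notation P := (polymatroid_polytope f).
Local Notation cell := (cell f).
Local Notation slope := (slope f).
Local Notation slopes := (slopes f).
Local Notation string := (string f).
Local Notation shadow := (shadow coordsum).
Implicit Types (w u x y : V) (A B : {set E}) (a t s : R).

(** The height over the line of slope [t] through the origin; along [shadow w] it pulls back to
    [tilt w t]. *)
Definition line_height t (p : R * R) : R := p.2 - t * p.1.

Fact line_height_is_linear t : scalar (line_height t).
Proof.
move=> a x y; rewrite -[LHS]/(a * x.2 + y.2 - t * (a * x.1 + y.1)) /line_height.
ring.
Qed.

HB.instance Definition _ t := GRing.isLinear.Build R (R * R)%type R *%R
  (line_height t) (line_height_is_linear t).

Lemma dot_is_scalar w : scalar (dot w).
Proof. by move=> a x y; rewrite -!(tilt0 w) linearP. Qed.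

HB.instance Definition _ w :=
  GRing.isLinear.Build R V R *%R (dot w) (dot_is_scalar w).

Lemma coordsum_conv a x y :
  coordsum (a *: x + (1 - a) *: y) = a * coordsum x + (1 - a) * coordsum y.
Proof. exact: (scalar_conv coordsum). Qed.

Lemma shadow_conv w a x y :
  shadow w (a *: x + (1 - a) *: y) = a *: shadow w x + (1 - a) *: shadow w y.
Proof.
rewrite /Defs.shadow; congr pair; first exact: coordsum_conv.
exact: (scalar_conv (dot w)).
Qed.

Lemma polytope_convex : is_convex P.
Proof.
move=> x y a [x0 xf] [y0 yf] /andP[a0 a1]; split=> [e|A].
  have := x0 e; have := y0 e; rewrite !ffunE => h1 h2.
  by rewrite addr_ge0 // mulr_ge0 // subr_ge0.
under eq_bigr do rewrite !ffunE.
rewrite big_split /= -!mulr_sumr; have := xf A; have := yf A; nra.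
Qed.

Lemma cell_convex w t : is_convex (cell w t).
Proof. exact/face_max_convex/polytope_convex. Qed.

(** [tilt w t] is constant on the face it exposes, so the shadow of the cell lies on a line of slope
    [t]. *)
Lemma cell_dot w t x y : cell w t x -> cell w t y ->
  dot w x = dot w y + t * (coordsum x - coordsum y).
Proof.
move=> [Px /(_ y)xm] [Py /(_ x)ym]; have := xm Py; have := ym Px.
rewrite /tilt; lra.
Qed.

Lemma shadow_cell_face w t :
  shadow w @` cell w t = face_max (line_height t) (shadow w @` P).
Proof.
apply/seteqP; split=> [_ [x [Px xmax] <-]|p [[x Px <-] xmax]].
  split=> [|_ [y Py <-]]; [by exists x | exact: xmax].
by exists x => //; split=> // y Py; apply: (xmax (shadow w y)); exists y.
Qed.

Lemma cell_preimage w t : cell w t = P `&` shadow w @^-1` (shadow w @` cell w t).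
Proof.
apply/seteqP; split=> x; first by move=> xt; split; [exact: xt.1|exists x].
by move=> [Px [y yt [cxy dxy]]]; apply: (slice_eq Px yt).
Qed.

Lemma not_above_upper w x y : P x -> P y -> coordsum x = coordsum y ->
  upper_boundary (shadow w @` P) (shadow w x) -> dot w y <= dot w x.
Proof.
move=> Px Py cxy [_ up]; rewrite leNgt; apply/negP => xy.
have := up (dot w y - dot w x); rewrite subr_gt0 => /(_ xy); apply.
by exists y => //; rewrite /Defs.shadow /= addrC subrK cxy.
Qed.

(** By [cell_dot] and convexity the shadow is the segment between the shadows of a lowest and a
    highest point. It is on the upper boundary because cell points maximize [w] in their slices. *)
Lemma shadow_cell_edge w t : slope w t ->
  upper_edge (shadow w @` P) (shadow w @` cell w t).
Proof.
move=> st; split; last first.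
  move=> _ [x xt <-]; split=> [|eps e0 [y Py [/= cyx dyx]]].
    by exists x => //; exact: xt.1.
  by have := slice_le Py xt cyx; rewrite dyx; lra.
split; first split.
- by have [[x xt] _] := cell_face hf w t; exists (shadow w x), x.
- by exists (line_height t); exact: shadow_cell_face.
have [|x xt cx] := @cell_point _ _ _ hf w t (f (sgt w t)).
  by rewrite lexx sgt_le_sge.
have [|y yt cy] := @cell_point _ _ _ hf w t (f (sge w t)).
  by rewrite lexx sgt_le_sge.
have xy : coordsum x < coordsum y by rewrite cx cy.
exists (shadow w x), (shadow w y); split; first by case=> cxy; rewrite cxy ltxx in xy.
apply/seteqP; split=> [_ [z zt <-]|_ [a a01 <-]]; last first.
  by rewrite -shadow_conv; exists (a *: x + (1 - a) *: y) => //; exact: cell_convex.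
have d0 : coordsum y - coordsum x != 0 by rewrite subr_eq0 gt_eqF.
have d1 : 0 < coordsum y - coordsum x by rewrite subr_gt0.
have /andP[z1 z2] := cell_range hf zt.
pose a := (coordsum y - coordsum z) / (coordsum y - coordsum x).
exists a => /=.
  by rewrite divr_ge0 ?ler_pdivrMr //= ?mul1r ?subr_ge0 ?lerD2l ?lerN2 ?cx ?cy ?sgt_le_sge.
have ez : a * coordsum x + (1 - a) * coordsum y = coordsum z by rewrite /a; field.
apply: injective_projections => /=; first exact: ez.
rewrite -[RHS](addrNK (dot w y)) -[LHS]/(a * dot w x + (1 - a) * dot w y).
by rewrite (cell_dot xt yt) (cell_dot zt yt) -ez; ring.
Qed.

(** The midpoint of an upper edge is [w]-maximal in its slice, so it lies in a cell, which then
    contains points over both endpoints. Conversely the edge, as a face of the shadow, absorbs the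
    shadow of every point of that cell. *)
Lemma upper_edge_cell w e : upper_edge (shadow w @` P) e ->
  exists2 t, slope w t & e = shadow w @` cell w t.
Proof.
move=> [[[_ [u eu]] [p [q [pq epq]]]] eup].
have ep : e p by rewrite epq; exists 1; rewrite /= ?ler01 ?lexx // subrr scale1r scale0r addr0.
have eq : e q by rewrite epq; exists 0; rewrite /= ?ler01 ?lexx // subr0 scale1r scale0r add0r.
have [x Px xp] : (shadow w @` P) p by move: ep; rewrite eu => -[].
have [y Py yq] : (shadow w @` P) q by move: eq; rewrite eu => -[].
subst p q.
have cxy : coordsum x != coordsum y.
  apply/eqP => cxy; apply: pq; apply: injective_projections; first exact: cxy.
  apply/le_anti => /=.
  by rewrite (not_above_upper Py Px _ (eup _ eq)) // (not_above_upper Px Py _ (eup _ ep)).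
have h2 : 0 <= (2^-1 : R) <= 1 by apply/andP; split; lra.
pose z := 2^-1 *: x + (1 - 2^-1) *: y.
have Pz : P z by exact: polytope_convex.
have ez : e (shadow w z) by rewrite epq /z shadow_conv; exists 2^-1.
have cz : coordsum z = (coordsum x + coordsum y) / 2.
  by rewrite /z coordsum_conv; field.
have /andP[x0 x1] := polytope_range Px; have /andP[y0 y1] := polytope_range Py.
have [|t st /andP[tz zt]] := @slope_upper _ _ _ hf w (coordsum z).
  by move/eqP: cxy => cxy; apply/andP; split; rewrite ?cz; lra.
have zc : cell w t z.
  have [|v vt cv] := @cell_point _ _ _ hf w t (coordsum z); first by rewrite ltW.
  apply: (slice_eq Pz vt) => //; apply/le_anti; rewrite (slice_le Pz vt) //=.
  by apply: not_above_upper (eup _ ez) => //; exact: vt.1.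
have xc : cell w t x by apply: (face_max_absorb Px Py _ zc); apply/andP; split; lra.
have yc : cell w t y.
  apply: (@face_max_absorb _ _ _ _ y x 2^-1 Py Px); first by apply/andP; split; lra.
  suff -> : 2^-1 *: y + (1 - 2^-1) *: x = z by [].
  by rewrite /z addrC; congr (_ *: _ + _ *: _); field.
exists t => //; apply/seteqP; split=> v.
  rewrite epq => -[a a01 <-]; rewrite -shadow_conv.
  by exists (a *: x + (1 - a) *: y) => //; exact: cell_convex.
move=> [v' vt <-].
have /andP[v1 v2] := cell_range hf vt.
have /andP[cx1 cx2] := cell_range hf xc; have /andP[cy1 cy2] := cell_range hf yc.
(* [v''] is taken at the end of the cell on the far side of [z] from [v'], so that [v'] gets
   positive weight. *)
have [v'' vt'' [a a01 ea]] : exists2 v'', cell w t v'' & exists2 a, 0 < a <= 1 &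
    coordsum z = a * coordsum v' + (1 - a) * coordsum v''.
  case: (leP (coordsum v') (coordsum z)) => vz.
    have [|v'' ? cv''] := @cell_point _ _ _ hf w t (f (sge w t)).
      by rewrite lexx sgt_le_sge.
    have zlt : coordsum z < f (sge w t) by move/eqP: cxy; rewrite cz; lra.
    have d0 : 0 < f (sge w t) - coordsum v' by lra.
    exists v'' => //; exists ((f (sge w t) - coordsum z) / (f (sge w t) - coordsum v')).
      by rewrite divr_gt0 ?ler_pdivrMr // ?mul1r ?subr_gt0 // lerD2l lerN2.
    by rewrite cv''; field; rewrite gt_eqF.
  have [|v'' ? cv''] := @cell_point _ _ _ hf w t (f (sgt w t)).
    by rewrite lexx sgt_le_sge.
  have d0 : 0 < coordsum v' - f (sgt w t) by lra.
  exists v'' => //; exists ((coordsum z - f (sgt w t)) / (coordsum v' - f (sgt w t))).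
    by rewrite divr_gt0 ?ler_pdivrMr // ?mul1r ?subr_gt0 // lerD2r ltW.
  by rewrite cv''; field; rewrite gt_eqF.
rewrite eu; apply: (@face_max_absorb _ _ u _ _ (shadow w v'') a) => //.
- by exists v' => //; exact: vt.1.
- by exists v'' => //; exact: vt''.1.
suff <- : shadow w z = a *: shadow w v' + (1 - a) *: shadow w v'' by rewrite -eu.
apply: injective_projections => //=.
rewrite -[RHS]/(a * dot w v' + (1 - a) * dot w v'').
by rewrite (cell_dot zc vt'') (cell_dot vt vt'') ea; ring.
Qed.

Lemma string_coherent w : coherent_string_of P coordsum w (string w).
Proof.
exists [seq shadow w @` cell w t | t <- slopes w]; last first.
  by rewrite -map_comp; apply: eq_map => t /=; exact: cell_preimage.
split=> [e|i j]; first split.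
- by move=> /mapP[t]; rewrite mem_slopes => st ->; exact: shadow_cell_edge.
- by move=> /upper_edge_cell[t st ->]; apply: map_f; rewrite mem_slopes.
rewrite size_map => /andP[ij jn] p q; rewrite !(nth_map 0) ?(ltn_trans ij) //.
move=> [x /(cell_range hf)/andP[_ xt] <-] [y /(cell_range hf)/andP[yt _] <-] /=.
apply: (le_trans xt); apply: le_trans yt; apply: (polymatroid_mono hf).
by apply/sge_sub_sgt/decreasing_nth; rewrite ?ij //; exact: slopes_sorted.
Qed.

End Coherence.

(** * Refinement *)
Section Refinement.
Variables (R : realType) (V : lmodType R) (c : {scalar V}).
Implicit Types (s t : seq (set V)).

Definition carrier s : set V := [set x | exists2 F, F \in s & F x].

Lemma refines_carrier s t : refines c s t -> carrier s `<=` carrier t.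
Proof.
move=> [ss [sst -> hss]] x [F /flattenP[l /(nthP [::])[i]]].
rewrite sst => it <- /(nthP set0)[j jl <-] Fx.
exists (nth set0 t i); first exact: mem_nth.
by have [_ /(_ j jl)[[_ [u uE]] _] _ _ _] := hss i it; move: Fx; rewrite uE => -[].
Qed.

(** Antisymmetry of refinement rests on this: each block has an entry, so equal sizes leave no room
    for a second one. *)
Lemma size_flatten_nonempty (T : eqType) (ss : seq (seq T)) : [::] \notin ss ->
  (size ss <= size (flatten ss))%N /\
  (size ss = size (flatten ss) -> ss = [seq [:: x] | x <- flatten ss]).
Proof.
elim: ss => // l ss IH; rewrite inE negb_or eq_sym => /andP[l0 /IH[le eq]].
case: l l0 => // x l _ /=; rewrite size_cat ltnS (leq_trans le) ?leq_addl //.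
split=> // -[] h; have l0 : l = [::].
  apply/nilP; rewrite /nilp; move: h le => ->.
  by rewrite -{2}[size (flatten _)]add0n leq_add2r leqn0.
by move: h; rewrite l0 => /eq <-.
Qed.

Lemma refines_size s t : refines c s t -> (size t <= size s)%N /\
  (size t = size s -> forall i, (i < size t)%N -> nth set0 s i `<=` nth set0 t i).
Proof.
move=> [ss [sst -> hss]].
have ss0 : [::] \notin ss.
  apply/negP => /(nthP [::])[i]; rewrite sst => /hss[+ _ _ _ _] e.
  by rewrite e.
have [le eq] := size_flatten_nonempty ss0; rewrite -sst; split=> // /eq ssE i iss.
have it := iss; rewrite sst in it.
have [_ + _ _ _] := hss i it; rewrite {1 2}ssE.
have isf : (i < size (flatten ss))%N by exact: leq_trans iss le.
rewrite (nth_map set0) // => /(_ 0%N isT)[[_ [u /= ->]] _] x.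
by case.
Qed.

Lemma refines_antisym s t : refines c s t -> refines c t s -> s = t.
Proof.
move=> /refines_size[l1 h1] /refines_size[l2 h2].
have e : size t = size s by apply/eqP; rewrite eqn_leq l1 l2.
apply: (@eq_from_nth _ set0) => // i i_s; apply/seteqP; split.
  by apply: h1; rewrite ?e.
exact: h2.
Qed.

End Refinement.

(** * From inclusion of carriers to refinement *)

Section StringRefinement.
Variables (R : realType) (E : finType) (f : {set E} -> R).
Hypothesis hf : polymatroid f.
Local Notation V := {ffun E -> R}.
Local Notation cell := (cell f).
Local Notation slope := (slope f).
Local Notation slopes := (slopes f).
Local Notation string := (string f).
Implicit Types (x y : V) (A B : {set E}) (a t s : R).

Let fmono A B : A \subset B -> f A <= f B. Proof. exact: polymatroid_mono. Qed.

Lemma carrier_string w x : carrier (string w) x <-> exists2 t, slope w t & cell w t x.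
Proof.
split=> [[F /mapP[t]]|[t st xt]]; first by rewrite mem_slopes => st -> xt; exists t.
by exists (cell w t) => //; apply: map_f; rewrite mem_slopes.
Qed.

Variables w w' : V.
Hypothesis ww' : carrier (string w) `<=` carrier (string w').

(** A point of the cell at the inner height [a] lies in [cell w' t']. Chosen between a lowest and a
    highest point, it brings both into that face; so the range of [t] lies within that of [t'], and
    [cell_slice] takes over all other points. *)
Lemma cell_sub t t' a : slope w t -> f (sgt w t) < a < f (sge w t) ->
  f (sgt w' t') <= a <= f (sge w' t') -> cell w t `<=` cell w' t'.
Proof.
move=> st /andP[ta at_] ta'.
have [|x xt cx] := @cell_point _ _ _ hf w t (f (sgt w t)); first by rewrite lexx sgt_le_sge.
have [|y yt cy] := @cell_point _ _ _ hf w t (f (sge w t)); first by rewrite lexx sgt_le_sge.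
have d0 : 0 < f (sge w t) - f (sgt w t) by rewrite subr_gt0.
pose b := (f (sge w t) - a) / (f (sge w t) - f (sgt w t)).
have /andP[b0 b1] : 0 < b < 1.
  by rewrite divr_gt0 ?ltr_pdivrMr // ?mul1r ?subr_gt0 // ltrD2l ltrN2.
pose m := b *: x + (1 - b) *: y.
have cm : coordsum m = a.
  by rewrite /m coordsum_conv cx cy /b; field; rewrite gt_eqF.
have mt : cell w t m by apply: cell_convex => //; rewrite !ltW.
have [|t'' _ mt''] := proj1 (carrier_string w' m) _.
  by apply: ww'; apply/carrier_string; exists t.
have mt' : cell w' t' m by apply: (cell_slice hf mt''); rewrite cm.
have xt' : cell w' t' x.
  by apply: (face_max_absorb xt.1 yt.1 _ mt'); rewrite b0 ltW.
have yt' : cell w' t' y.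
  apply: (@face_max_absorb _ _ _ _ y x (1 - b) yt.1 xt.1).
    by apply/andP; split; lra.
  suff -> : (1 - b) *: y + (1 - (1 - b)) *: x = m by [].
  by rewrite /m addrC; congr (_ *: _ + _); ring.
have /andP[h1 _] := cell_range hf xt'; have /andP[_ h2] := cell_range hf yt'.
move=> z zt; have /andP[z1 z2] := cell_range hf zt.
have [|s _ zs] := proj1 (carrier_string w' z) _.
  by apply: ww'; apply/carrier_string; exists t.
by apply: (cell_slice hf zs); apply/andP; split; lra.
Qed.

(** Otherwise some cell of [w] has the breakpoint inside its range; by [cell_sub] it lies in
    [cell w' t'], whose points do not go below the breakpoint. *)
Lemma breakpoint_lower t' : slope w' t' ->
  exists2 t, slope w t & f (sgt w t) = f (sgt w' t').
Proof.
move=> st'; have [|t st /andP[h1 h2]] := @slope_lower _ _ _ hf w (f (sgt w' t')).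
  case: hf => _ fge0 _; rewrite fge0 /=; apply: lt_le_trans st' _.
  exact/fmono/finset.subsetT.
exists t => //; apply/le_anti; rewrite h1 leNgt; apply/negP => h3.
have [|x xt cx] := @cell_point _ _ _ hf w t (f (sgt w t)); first by rewrite lexx sgt_le_sge.
have := @cell_sub t t' (f (sgt w' t')) st; rewrite h3 h2 lexx sgt_le_sge //.
by move=> /(_ isT isT _ xt)/(cell_range hf)/andP[]; rewrite cx; lra.
Qed.

Lemma breakpoint_upper t' : slope w' t' ->
  exists2 t, slope w t & f (sge w t) = f (sge w' t').
Proof.
move=> st'; have [|t st /andP[h1 h2]] := @slope_upper _ _ _ hf w (f (sge w' t')).
  case: hf => _ fge0 _; rewrite (le_lt_trans (fge0 _) st') /=.
  exact/fmono/finset.subsetT.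
exists t => //; apply/le_anti; rewrite h2 andbT leNgt; apply/negP => h3.
have [|x xt cx] := @cell_point _ _ _ hf w t (f (sge w t)); first by rewrite lexx sgt_le_sge.
have := @cell_sub t t' (f (sge w' t')) st; rewrite h3 h1 lexx sgt_le_sge //.
by move=> /(_ isT isT _ xt)/(cell_range hf)/andP[]; rewrite cx; lra.
Qed.

(** Each cell of [w] is assigned to the cell of [w'] whose range contains its lower end; the cells
    assigned to [t'] form the block that replaces [cell w' t']. *)
Lemma carrier_refines : refines coordsum (string w) (string w').
Proof.
(* Half-open, so that a lower end at a breakpoint of [w'] is assigned to only one slope. *)
pose K t' t := f (sgt w' t') <= f (sgt w t) < f (sge w' t').
have /choice[k kP] t : exists t', slope w t -> slope w' t' /\ K t' t.
  case: (boolP (slope w t)) => st; last by exists 0.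
  have [|t' st' h] := @slope_lower _ _ _ hf w' (f (sgt w t)); last by exists t'.
  case: hf => _ -> _; apply: lt_le_trans st _; exact/fmono/finset.subsetT.
have K_uniq t1 t2 t : slope w' t1 -> slope w' t2 -> K t1 t -> K t2 t -> t1 = t2.
  move=> s1 s2 /andP[h1 h2] /andP[h3 h4]; apply/le_anti/andP; split.
    by apply: (slope_order hf s2 s1); exact: le_lt_trans h3 h2.
  by apply: (slope_order hf s1 s2); exact: le_lt_trans h1 h4.
have kE t t' : slope w t -> slope w' t' -> K t' t -> k t = t'.
  by move=> /kP[s1 k1] s2; exact: K_uniq.
exists [seq [seq cell w t | t <- slopes w & k t == t'] | t' <- slopes w']; split.
- by rewrite !size_map.
- rewrite (map_comp (map (cell w))) -map_flatten; congr map.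
  rewrite flatten_classes //; first exact: slopes_sorted.
    by move=> t; rewrite !mem_slopes => /kP[].
  have := slopes_sorted f w; rewrite (sorted_pairwise (@gt_transitive R)).
  apply: (sub_in_pairwise (P := slope w)) => [t1 t2 s1 s2 t21|]; last first.
    by apply/allP => t; rewrite mem_slopes.
  have [s1' /andP[h1 h2]] := kP _ s1; have [s2' /andP[h3 h4]] := kP _ s2.
  apply: (slope_order hf s1' s2').
  by apply: le_lt_trans h4; apply: (le_trans h1); apply/fmono/sgtS/ltW.
move=> i; rewrite size_map => i_n; rewrite !(nth_map 0) //.
have := mem_nth 0 i_n; rewrite mem_slopes; set t' := nth 0 _ i => st'.
set T := [seq t <- _ | _].
have memT t : (t \in T) = slope w t && (k t == t').
  by rewrite mem_filter mem_slopes andbC.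
have sT : sorted (fun a b => b < a) T.
  by apply: (sorted_filter (@gt_transitive R)); exact: slopes_sorted.
have KT t : t \in T -> slope w t /\ K t' t.
  by rewrite memT => /andP[st /eqP <-]; have [] := kP _ st.
(* The slopes [t0] and [t1] make the block start and end exactly where [cell w' t'] does. *)
have [t0 s0 e0] := breakpoint_lower st'.
have T0 : t0 \in T.
  by rewrite memT s0; apply/eqP/kE; rewrite // /K e0 lexx.
have [t1 s1 e1] := breakpoint_upper st'.
have T1 : t1 \in T.
  rewrite memT s1; apply/eqP/kE; rewrite // /K -e1 [X in _ && X]s1 andbT leNgt.
  apply/negP => h; have [x xt cx] : exists2 x, cell w t1 x & coordsum x = f (sgt w t1).
    by apply: cell_point => //; rewrite lexx sgt_le_sge.
  have mid : f (sgt w t1) < f (sgt w' t') < f (sge w t1) by rewrite h e1; exact: st'.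
  have := @cell_sub t1 t' _ s1 mid; rewrite lexx sgt_le_sge // => /(_ isT _ xt).
  by move=> /(cell_range hf)/andP[]; rewrite cx; lra.
apply: cellular_sublist => //.
- by move=> eT; rewrite eT in T0.
- move=> t /KT[st /andP[h1 h2]]; split=> //.
  have [[x xt] [u uE]] := cell_face hf w t; split; first by exists x.
  (* With the smaller upper end [a], the midpoint of the lower end and [a] is interior to the range
     of [t] and within the range of [t']. *)
  pose a := Num.min (f (sge w t)) (f (sge w' t')).
  have sub : cell w t `<=` cell w' t'.
    apply: (@cell_sub t t' ((f (sgt w t) + a) / 2) st).
      have : a <= f (sge w t) by rewrite ge_min lexx.
      have : f (sgt w t) < a by rewrite lt_min h2 [X in X && _](st : f _ < f _).
      by move=> ? ?; apply/andP; split; lra.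
    have : a <= f (sge w' t') by rewrite ge_min lexx orbT.
    have : f (sgt w t) < a by rewrite lt_min h2 [X in X && _](st : f _ < f _).
    by move=> ? ?; apply/andP; split; lra.
  exists u; apply/seteqP; split=> y yt.
    split; first exact: sub.
    by move: yt; rewrite uE => -[_ ymax] z [/ymax].
  rewrite uE; split=> [|z Pz]; first exact: yt.1.1.
  by have := xt; rewrite uE => -[_ /(_ z Pz)]/le_trans; apply; exact/yt.2/sub.
- move=> ta tb t /KT[sa /andP[a1 a2]] /KT[sb /andP[b1 b2]] st /andP[bt ta_].
  rewrite memT st; apply/eqP/kE => //; apply/andP; split.
    by apply: (le_trans a1); apply/fmono/sgtS/ltW.
  by apply: le_lt_trans b2; apply/fmono/sgtS/ltW.
move=> x /(cell_range hf)/andP[x0 x1].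
case: T sT T0 T1 {memT KT} => // tm T /= sT /(decreasing_bounds sT)/andP[_ T0].
move=> /(decreasing_bounds sT)/andP[T1 _]; apply/andP; split.
  by apply: le_trans x0; rewrite -e0; apply/fmono/sgtS.
by apply: (le_trans x1); rewrite -e1; apply/fmono/sgeS.
Qed.

End StringRefinement.

(** * Monotone path polytope *)
Section IntervalIntegrals.
Variable R : realType.
Variables a b : R.
Hypothesis ab : a < b.
Local Notation mu := (@lebesgue_measure R).
Implicit Types g h : R -> R.

Lemma within_continuous_integrable g : {within `[a, b], continuous g} ->
  mu.-integrable `[a, b] (EFin \o g).
Proof.
move=> gc; apply: continuous_compact_integrable => //; exact: segment_compact.
Qed.

(** By continuity [h] is at least half of [h s0] on a nondegenerate interval containing [s0]. *)
Lemma within_continuous_integral_gt0 h s0 : {within `[a, b], continuous h} ->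
  (forall s, s \in `[a, b] -> 0 <= h s) -> s0 \in `[a, b] -> 0 < h s0 ->
  0 < \int[mu]_(s in `[a, b]) h s.
Proof.
move=> hc h0 s0ab hs0.
have /subspace_continuousP/(_ s0 s0ab)/cvgrPdist_lt/(_ (h s0 / 2)) := hc.
rewrite divr_gt0 // => /(_ isT); rewrite near_withinE.
move=> /nbhs_ballP[d /= d0 hd].
have {}d0 : 0 < d by exact: d0.
(* The cut-offs allow [s0] to be an endpoint; half the radius keeps the closed interval in the open
   ball. *)
pose u := Num.max a (s0 - d / 2); pose v := Num.min b (s0 + d / 2).
move: (s0ab); rewrite in_itv /= => /andP[as0 s0b].
have uv : u < v.
  by rewrite /u /v gt_max !lt_min; apply/andP; split; apply/andP; split=> //; lra.
have uvab : `[u, v] `<=` `[a, b].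
  move=> s /=; rewrite !in_itv /= ge_max le_min.
  by move=> /andP[/andP[-> _] /andP[-> _]].
have h2 s : s \in `[u, v] -> h s0 / 2 <= h s.
  move=> suv; have sab := uvab s suv.
  have : ball s0 d s.
    move: suv; rewrite in_itv /= ge_max le_min /ball /= => /andP[/andP[_ h1] /andP[_ h2]].
    by rewrite ltr_norml; apply/andP; split; lra.
  move=> /hd /(_ sab) hs; have {hs} : `|h s0 - h s| < h s0 / 2 by exact: hs.
  by rewrite ltr_norml => /andP[_]; lra.
have ih := within_continuous_integrable hc.
rewrite -lte_fin fineK; last exact: integrable_fin_num.
have mh := measurable_int _ ih.
apply: (@lt_le_trans _ _ (\int[mu]_(s in `[u, v]) cst (h s0 / 2)%:E s)%E).
  rewrite integral_cst //= lebesgue_measure_itv /= lte_fin uv -EFinD -EFinM lte_fin.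
  by rewrite mulr_gt0 ?divr_gt0 // subr_gt0.
apply: (@le_trans _ _ (\int[mu]_(s in `[u, v]) (h s)%:E)%E).
  apply: ge0_le_integral => //.
  - by move=> s _; rewrite lee_fin divr_ge0 // ltW.
  - exact: measurable_funS mh.
apply: ge0_subset_integral => // s sab; rewrite lee_fin; exact: h0.
Qed.

Lemma within_continuous_integral_eq g h :
  {within `[a, b], continuous g} -> {within `[a, b], continuous h} ->
  (forall s, s \in `[a, b] -> g s <= h s) ->
  \int[mu]_(s in `[a, b]) h s <= \int[mu]_(s in `[a, b]) g s ->
  forall s, s \in `[a, b] -> g s = h s.
Proof.
move=> gc hc gh ihg s sab; apply/le_anti; rewrite gh //= leNgt; apply/negP => lt.
have hgc : {within `[a, b], continuous (fun s => h s - g s)}.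
  by move=> x; apply: cvgB; [exact: hc|exact: gc].
have hg0 x : x \in `[a, b] -> 0 <= h x - g x by move=> ?; rewrite subr_ge0 gh.
have := within_continuous_integral_gt0 hgc hg0 sab.
rewrite RintegralB //; try exact: within_continuous_integrable.
by rewrite !subr_gt0 => /(_ lt); rewrite ltNge ihg.
Qed.

Lemma within_continuous_sum (I : Type) (r : seq I) (c : I -> R) (g : I -> R -> R) :
  (forall i, {within `[a, b], continuous (g i)}) ->
  {within `[a, b], continuous (fun s => \sum_(i <- r) c i * g i s)} /\
  \int[mu]_(s in `[a, b]) (\sum_(i <- r) c i * g i s) =
  \sum_(i <- r) c i * \int[mu]_(s in `[a, b]) g i s.
Proof.
move=> gc; elim: r => [|i r [IHc IHi]].
  have -> : (fun s => \sum_(i <- [::]) c i * g i s) = cst 0.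
    by apply/funext => s; rewrite big_nil.
  by split; [move=> x; exact: cvg_cst|rewrite Rintegral_cst // mul0r big_nil].
have cgc : {within `[a, b], continuous (fun s => c i * g i s)}.
  by move=> x; apply: cvgM; [exact: cvg_cst|exact: gc].
have -> : (fun s => \sum_(j <- i :: r) c j * g j s) =
    (fun s => c i * g i s + \sum_(j <- r) c j * g j s).
  by apply/funext => s; rewrite big_cons.
split; first by move=> x; apply: cvgD; [exact: cgc|exact: IHc].
rewrite RintegralD //; try exact: within_continuous_integrable.
by rewrite IHi big_cons RintegralZl //; exact: within_continuous_integrable.
Qed.

End IntervalIntegrals.

(** * Sections following a string and faces of the monotone path polytope *)

Section MonotonePathPolytope.
Variables (R : realType) (E : finType) (f : {set E} -> R).
Hypothesis hf : polymatroid f.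
Hypothesis hfE : 0 < f [set: E]%SET.
Local Notation V := {ffun E -> R}.
Local Notation P := (polymatroid_polytope f).
Local Notation cell := (cell f).
Local Notation slope := (slope f).
Local Notation string := (string f).
Local Notation MPP := (monotone_path_polytope P coordsum).
Implicit Types (w x y : V) (A B : {set E}) (a t s : R) (gamma : R -> V).

Lemma coordsum_image : coordsum @` P = [set` `[0, f [set: E]%SET]].
Proof.
apply/seteqP; split=> [_ [x /polytope_range ? <-]|s].
  by rewrite /= in_itv.
rewrite /= in_itv /= => sE; have [gamma [_ /(_ s sE)[Pg cg _]]] := cell_section hf 0.
by exists (gamma s).
Qed.

Definition path_integral gamma : V :=
  [ffun e => 2 * \int[lebesgue_measure]_(s in coordsum @` P) gamma s e].

Definition follows (l : seq (set V)) gamma : Prop :=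
  forall s, (coordsum @` P) s -> carrier l (gamma s).

(** The map of the isomorphism, defined on lists of sets so that no weight has to be chosen. *)
Definition string_face (l : seq (set V)) : set V :=
  [set path_integral gamma | gamma in [set g | is_section P coordsum g /\ follows l g]].

Lemma follows_string_exists w : exists gamma,
  [/\ forall e, continuous (fun s => gamma s e), is_section P coordsum gamma &
      follows (string w) gamma].
Proof.
have [gamma [gc hg]] := cell_section hf w.
exists gamma; rewrite /is_section /follows coordsum_image; split=> //.
  split=> [s|e]; last exact/continuous_subspaceT/gc.
  by rewrite /= in_itv /= => /hg[].
move=> s; rewrite /= in_itv /= => sE; have [_ cg gt] := hg s sE.
apply/(carrier_string f w); have [s0 sE'] := andP sE.
move: s0; rewrite le_eqVlt => /orP[/eqP s0|s0].
  have [|t st /andP[h1 h2]] := @slope_lower _ _ _ hf w s; first by rewrite -s0 lexx.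
  by exists t => //; apply: gt; rewrite h1 ltW.
have [|t st /andP[h1 h2]] := @slope_upper _ _ _ hf w s; first by rewrite s0.
by exists t => //; apply: gt; rewrite ltW.
Qed.

Lemma section_dot w gamma : is_section P coordsum gamma ->
  {within [set` `[0, f [set: E]%SET]], continuous (fun s => dot w (gamma s))} /\
  dot w (path_integral gamma) =
    2 * \int[lebesgue_measure]_(s in `[0, f [set: E]%SET]) dot w (gamma s).
Proof.
move=> [_ gc]; rewrite coordsum_image in gc.
have [dc di] := within_continuous_sum (index_enum E) w gc.
split; first exact: dc.
have {}di : \int[lebesgue_measure]_(s in `[0, f [set: E]%SET]) dot w (gamma s) =
  \sum_e w e * \int[lebesgue_measure]_(s in `[0, f [set: E]%SET]) gamma s e := di.
rewrite di mulr_sumr.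
by apply: eq_bigr => e _; rewrite ffunE coordsum_image mulrCA.
Qed.

Lemma carrier_max w x y : P x -> carrier (string w) y -> coordsum x = coordsum y ->
  dot w x <= dot w y /\ (dot w x = dot w y <-> carrier (string w) x).
Proof.
move=> Px /(carrier_string f w)[t st yt] cxy; split; first exact: slice_le Px yt cxy.
split=> [dxy|/(carrier_string f w)[t' st' xt']].
  by apply/(carrier_string f w); exists t => //; exact: slice_eq Px yt cxy dxy.
apply/le_anti; rewrite (slice_le Px yt cxy) /=.
exact: (slice_le yt.1 xt' (esym cxy)).
Qed.

(** Sections are compared with one section [delta] that follows the string and so maximizes [w]
    pointwise. By continuity, a section with the same integral of [w] agrees with [delta] in [w]
    everywhere, hence stays in the cells. *)
Lemma section_face_max w gamma : is_section P coordsum gamma ->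
  face_max (dot w) MPP (path_integral gamma) <-> follows (string w) gamma.
Proof.
move=> gs; have [gc gi] := section_dot w gs.
have [delta [_ ds df]] := follows_string_exists w; have [dc di] := section_dot w ds.
have le_delta g : is_section P coordsum g -> forall s, s \in `[0, f [set: E]%SET] ->
    dot w (g s) <= dot w (delta s) /\
    (dot w (g s) = dot w (delta s) <-> carrier (string w) (g s)).
  move=> [gP _] s sE; have sI : (coordsum @` P) s by rewrite coordsum_image.
  have [Pg cg] := gP s sI; have [Pd cd] := ds.1 s sI.
  by apply: (carrier_max Pg (df s sI)); rewrite cg cd.
split=> [[_ /(_ (path_integral delta))] h|gf].
  move=> s; rewrite coordsum_image => sE; apply/(le_delta _ gs s sE).2.
  apply: (within_continuous_integral_eq hfE gc dc) => //.
    by move=> r /(le_delta _ gs)[].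
  have : dot w (path_integral delta) <= dot w (path_integral gamma).
    by apply: h; exists delta.
  by rewrite gi di ler_pM2l.
split=> [|_ [g hg <-]]; first by exists gamma.
have [hgc hgi] := section_dot w hg.
rewrite -[X in dot w X <= _]/(path_integral g) hgi gi ler_pM2l //.
apply: le_Rintegral => //; try exact: within_continuous_integrable.
move=> s sE; have [h _] := le_delta _ hg s sE; have [_ h2] := le_delta _ gs s sE.
by rewrite h2.2 //; apply: gf; rewrite coordsum_image.
Qed.

Lemma string_faceE w : string_face (string w) = face_max (dot w) MPP.
Proof.
apply/seteqP; split=> [_ [g [gs gf] <-]|x xmax].
  exact/section_face_max.
have [[g gs xg] _] := xmax; exists g => //; split=> //.
by apply/(section_face_max w gs); rewrite /path_integral xg.
Qed.

Lemma string_face_is_face w : is_face MPP (string_face (string w)).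
Proof.
split; last by exists (dot w); exact: string_faceE.
by have [g [_ gs gf]] := follows_string_exists w; exists (path_integral g), g.
Qed.

Let clamp a b s : R := Num.min (Num.max s a) b.

Let clamp_continuous a b : continuous (clamp a b).
Proof.
move=> s; apply: (@continuous_min R R (fun s => Num.max s a) (cst b) s).
  by apply: (@continuous_max R R id (cst a) s); [exact: cvg_id|exact: cvg_cst].
exact: cvg_cst.
Qed.

Let clamp_lo a b s : a <= b -> s <= a -> clamp a b s = a.
Proof. by move=> ab sa; rewrite /clamp max_r // min_l. Qed.

Let clamp_hi a b s : b <= s -> clamp a b s = b.
Proof. by move=> bs; rewrite /clamp min_r // le_max bs. Qed.

Let clamp_mid a b s : a <= s -> s <= b -> clamp a b s = s.
Proof. by move=> as_ sb; rewrite /clamp max_l // min_l. Qed.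

(* The polygonal path through the lower end of the cell, [m] and the upper end
   replaces a given path inside the cell. *)
Lemma section_through w t m : slope w t -> cell w t m ->
  f (sgt w t) < coordsum m < f (sge w t) ->
  exists gamma, [/\ is_section P coordsum gamma, follows (string w) gamma &
    gamma (coordsum m) = m].
Proof.
move=> st mt; set a := f (sgt w t); set b := f (sge w t); set k := coordsum m.
move=> /andP[ak kb]; have [delta [dc ds df]] := follows_string_exists w.
have fge0 A : 0 <= f A by case: hf.
have bE : b <= f [set: E]%SET by exact/(polymatroid_mono hf)/finset.subsetT.
have inI s : a <= s <= b -> (coordsum @` P) s.
  move=> /andP[as_ sb]; rewrite coordsum_image /= in_itv /=.
  by rewrite (le_trans (fge0 _) as_) (le_trans sb bE).
have delta_cell s : a <= s <= b -> cell w t (delta s) /\ coordsum (delta s) = s.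
  move=> sab; have [_ cd] := ds.1 s (inI s sab); split=> //.
  have /(carrier_string f w)[t' _ dt'] := df s (inI s sab).
  by apply: (cell_slice hf dt'); rewrite cd.
have [pt cp] := delta_cell a ltac:(rewrite lexx; lra).
have [qt cq] := delta_cell b ltac:(rewrite lexx; lra).
set p := delta a in pt cp; set q := delta b in qt cq.
pose lam s := clamp 0 1 ((s - a) / (k - a)); pose mu s := clamp 0 1 ((s - k) / (b - k)).
(* Inside the range the two [delta] terms cancel and the polygonal path remains. Outside, the
   polygonal path rests at an end, which the clamped [delta] cancels, and [delta s] remains. A
   single formula avoids gluing continuous pieces. *)
pose gamma s : V := [ffun e => p e + lam s * (m e - p e) + mu s * (q e - m e) +
                     delta s e - delta (clamp a b s) e].
have lam_lo s : s <= a -> lam s = 0.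
  by move=> sa; apply: clamp_lo => //; rewrite pmulr_lle0 ?invr_gt0; lra.
have lam_hi s : k <= s -> lam s = 1.
  by move=> ks; apply: clamp_hi; rewrite ler_pdivlMr; lra.
have mu_lo s : s <= k -> mu s = 0.
  by move=> sa; apply: clamp_lo => //; rewrite pmulr_lle0 ?invr_gt0; lra.
have mu_hi s : b <= s -> mu s = 1.
  by move=> ks; apply: clamp_hi; rewrite ler_pdivlMr; lra.
have gamma_out s : s <= a \/ b <= s -> gamma s = delta s.
  move=> [sa|bs]; apply/ffunP => e; rewrite ffunE.
    by rewrite lam_lo // mu_lo ?clamp_lo -/p; lra.
  by rewrite lam_hi ?mu_hi ?clamp_hi -/q; lra.
have gamma_in s : a <= s <= b -> cell w t (gamma s) /\ coordsum (gamma s) = s.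
  move=> /andP[as_ sb]; have [sk|ks] := leP s k.
    pose l := (s - a) / (k - a).
    have l01 : 0 <= l <= 1.
      by rewrite divr_ge0 ?ler_pdivrMr; try (apply/andP; split); lra.
    have -> : gamma s = l *: m + (1 - l) *: p.
      have laml : lam s = l by move: l01 => /andP[? ?]; exact: clamp_mid.
      apply/ffunP => e; rewrite !ffunE mu_lo // (clamp_mid as_ sb) laml.
      rewrite -[RHS]/(l * m e + (1 - l) * p e); ring.
    split; first exact: cell_convex.
    by rewrite coordsum_conv cp -/k /l; field; lra.
  pose l := (s - k) / (b - k).
  have l01 : 0 <= l <= 1.
    by rewrite divr_ge0 ?ler_pdivrMr; try (apply/andP; split); lra.
  have -> : gamma s = l *: q + (1 - l) *: m.
    have mul : mu s = l by move: l01 => /andP[? ?]; exact: clamp_mid.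
    apply/ffunP => e; rewrite !ffunE lam_hi ?(ltW ks) // (clamp_mid as_ sb) mul.
    rewrite -[RHS]/(l * q e + (1 - l) * m e); ring.
  split; first exact: cell_convex.
  by rewrite coordsum_conv cq -/k /l; field; lra.
have gammaP s : (coordsum @` P) s -> (P (gamma s) /\ coordsum (gamma s) = s) /\
    carrier (string w) (gamma s).
  move=> sI; have [sa|as_] := leP s a; last have [bs|sb] := leP b s.
  - by rewrite gamma_out; [split; [exact: ds.1|exact: df]|left].
  - by rewrite gamma_out; [split; [exact: ds.1|exact: df]|right].
  - have [gt cg] := gamma_in s ltac:(lra); split; first by split=> //; exact: gt.1.
    by apply/(carrier_string f w); exists t.
exists gamma; split; last first.
- apply/ffunP => e; rewrite ffunE lam_hi // mu_lo // clamp_mid; lra.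
- by move=> s /gammaP[].
split=> [s /gammaP[]//|e]; apply: continuous_subspaceT => s.
rewrite (_ : (fun s => gamma s e) = fun s => p e + lam s * (m e - p e) +
  mu s * (q e - m e) + delta s e - delta (clamp a b s) e); last first.
  by apply/funext => ?; rewrite ffunE.
have affc c d : continuous (fun s : R => clamp 0 1 ((s - c) / (d - c))).
  move=> r; apply: (@continuous_comp _ _ _ (fun s : R => (s - c) / (d - c)) (clamp 0 1)).
    by apply: cvgM; [apply: cvgB; [exact: cvg_id|exact: cvg_cst]|exact: cvg_cst].
  exact: clamp_continuous.
apply: cvgB; last first.
  apply: (@continuous_comp _ _ _ (clamp a b) (fun s => delta s e)).
    exact: clamp_continuous.
  exact: dc.
apply: cvgD; last exact: dc.
apply: cvgD; last by apply: cvgM; [exact: affc|exact: cvg_cst].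
by apply: cvgD; [exact: cvg_cst|apply: cvgM; [exact: affc|exact: cvg_cst]].
Qed.

(** Averaging [x] with a point [n] halfway between a lowest and a highest point of its cell gives
    [m] with an inner coordinate sum, so [section_through] applies. The integral lies in the face of
    [w'], so the section follows the string of [w'], and the cell of [w'] containing [m] absorbs
    [x]. *)
Lemma string_face_sub w w' : string_face (string w) `<=` string_face (string w') ->
  carrier (string w) `<=` carrier (string w').
Proof.
move=> ww' x /(carrier_string f w)[t st xt].
have [|p pt cp] := @cell_point _ _ _ hf w t (f (sgt w t)); first by rewrite lexx sgt_le_sge.
have [|q qt cq] := @cell_point _ _ _ hf w t (f (sge w t)); first by rewrite lexx sgt_le_sge.
have h2 : 0 <= (2^-1 : R) <= 1 by apply/andP; split; lra.
pose n := 2^-1 *: p + (1 - 2^-1) *: q; pose m := 2^-1 *: x + (1 - 2^-1) *: n.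
have nt : cell w t n by exact: cell_convex.
have mt : cell w t m by exact: cell_convex.
have /andP[x1 x2] := cell_range hf xt.
have pq : f (sgt w t) < f (sge w t) := st.
have [|gamma [gs gf gm]] := section_through st mt.
  by rewrite /m /n !coordsum_conv cp cq; apply/andP; split; lra.
have : string_face (string w') (path_integral gamma) by apply: ww'; exists gamma.
rewrite string_faceE => /(section_face_max w' gs)/(_ (coordsum m)).
rewrite gm => -[|F /mapP[t' + ->] mt'].
  by exists m => //; exact: mt.1.
rewrite mem_slopes => st'; apply/(carrier_string f w'); exists t' => //.
by apply: (face_max_absorb xt.1 nt.1 _ mt'); apply/andP; split; lra.
Qed.

End MonotonePathPolytope.

Theorem theorem3p1 (R : realType) (E : finType) (f : {set E} -> R)
    (hf : polymatroid f) (hfE : 0 < f [set: E]%SET) :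
  (forall s : seq (set {ffun E -> R}),
     cellular_string (polymatroid_polytope f) coordsum s ->
     coherent (polymatroid_polytope f) coordsum s) /\
  order_isomorphic
    [set s | cellular_string (polymatroid_polytope f) coordsum s]
    (refines coordsum)
    [set F | is_face (monotone_path_polytope (polymatroid_polytope f) coordsum) F]
    (fun F G => F `<=` G).
Proof.
split=> [s /(cellular_stringP hf hfE)[w ->]|].
  by exists w; exact: string_coherent.
have face_mono l l' : carrier l `<=` carrier l' -> string_face f l `<=` string_face f l'.
  by move=> ll' _ [g [gs gf] <-]; exists g => //; split=> // r rI; apply/ll'/gf.
exists (string_face f); split; first split.
- by move=> _ /(cellular_stringP hf hfE)[w ->]; exact: string_face_is_face.
(* Equal faces give inclusion of carriers both ways, hence mutual refinement. *)
- move=> s t /set_mem/(cellular_stringP hf hfE)[w ->].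
  move=> /set_mem/(cellular_stringP hf hfE)[w' ->] e.
  apply: (refines_antisym (c := coordsum)); apply: carrier_refines => //;
    by apply: string_face_sub; rewrite // e.
- move=> _ [_ [u ->]]; have [w uw] := scalarE u.
  exists (string f w); first exact: string_cellular.
  by rewrite string_faceE //; congr face_max; apply/funext => x; rewrite uw.
move=> _ _ /(cellular_stringP hf hfE)[w ->] /(cellular_stringP hf hfE)[w' ->].
split=> [/refines_carrier/face_mono//|/(string_face_sub hf hfE)].
exact: carrier_refines.
Qed.
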